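(* Let $\mathcal A$ and $\mathcal B$ be two strictly unital $A_\infty$-categories on sets $\mathbb A$ and $\mathbb B$, and let $f,g:\mathcal A\to\mathcal B$ be two strictly unital $A_\infty$-functors. An element $H\in Z^0\mathrm{Hom}_{\mathrm{Nunc}_\infty}(f,g)$ is a weak equivalence if and only if its component $h_0:e_{\mathbb A}\to\mathrm{Hom}_{\mathcal B}(\dot f?,\dot g-)$, i.e. the family of elements $h_A=h_0(\mathrm{id}_A)\in\mathcal B(\dot fA,\dot gA)$, $A\in\mathbb A$, induces an isomorphism of functors $H^0f\to H^0g$ from $H^0\mathcal A$ to $H^0\mathcal B$.
   Context: $\mathbb K$ is a field; everything is $\mathbb Z$-graded over $\mathbb K$ with Koszul signs; $(SM)^i=M^{i+1}$, $s:M\to SM$ canonical of degree $-1$, $\omega=s^{-1}$. An $A_\infty$-category $\mathcal A$ on a set $\mathbb A$ of objects: graded spaces $\mathcal A(A,A')$ and maps $m_n:\mathcal A(A_{n-1},A_n)\otimes\cdots\otimes\mathcal A(A_0,A_1)\to\mathcal A(A_0,A_n)$ ($n\ge1$) of degree $2-n$ with $\sum_{j+k+l=n}(-1)^{jk+l}m_{j+1+l}(\mathbf 1^{\otimes j}\otimes m_k\otimes\mathbf 1^{\otimes l})=0$; $b_n=-s\,m_n\,\omega^{\otimes n}$. Strictly unital: degree $0$ elements $\mathrm{id}_A$ that are units for $m_2$ and such that $m_n$, $n\ne2$, vanishes if one argument is an identity. $H^0\mathcal A$ is the category with morphisms the $H^0$ for $m_1$ and composition induced by $m_2$. Let $T^c(S\mathcal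 A)=\bigoplus_{i\ge0}(S\mathcal A)^{\odot i}$ ($\odot$ = tensor product over $\mathbb A$; the $i=0$ term is $e_{\mathbb A}$, i.e. $\mathbb K\cdot\mathrm{id}_A$ on each $(A,A)$ and $0$ on $(A,A')$, $A\ne A'$), with deconcatenation $\Delta$, iterated $\Delta^{(n)}$, and the differential $b$ given by the $b_n$ (zero on $i=0$). An $A_\infty$-functor $f:\mathcal A\to\mathcal B$: a map $\dot f$ on objects and $f_n:\mathcal A(A_{n-1},A_n)\otimes\cdots\otimes\mathcal A(A_0,A_1)\to\mathcal B(\dot fA_0,\dot fA_n)$ of degree $1-n$ such that $F_n=sf_n\omega^{\otimes n}$ ($n\ge1$) are the components of a dg coalgebra map; strictly unital: $f_1(\mathrm{id}_A)=\mathrm{id}_{\dot fA}$ and $f_n$ ($n\ge2$) vanishes if an argument is an identity. Write $F:T^c(S\mathcal A)\to S\mathcal B$ for the degree $0$ map with components $F_n$, $n\ge1$, and $0$ for $n=0$. $\mathrm{Nunc}_\infty(\mathcal A,\mathcal B)$ is the $A_\infty$-category whose objects are all $A_\infty$-functors $\mathcal A\to\mathcal B$, with $\mathrm{Hom}_{\mathrm{Nunc}_\infty}(f_1,f_2)$ the space of graded maps $T^c(S\mathcal A)(A,A')\to\mathcal B(\dot f_1A,\dot f_2A')$, $A,A'\in\mathbb A$; the restriction of $H$ to $e_{\mathbb A}$ is (up to the sign $(-1)^{|H|}$) the component $h_0$. Identifying $S\mathrm{Hom}(f_1,f_2)$ (via composition with $s$) with maps to $S\mathcal B$, its compositions (in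 the form $b_i=-sm_i\omega^{\otimes i}$), for $H_t\in S\mathrm{Hom}(f_{t-1},f_t)$, are $$b_i(H_i\otimes\cdots\otimes H_1)=\sum_{l_0,\dots,l_i\ge0}b^{\mathcal B}_{i+\sum l_t}\big(F_i^{\otimes l_0}\otimes H_i\otimes F_{i-1}^{\otimes l_1}\otimes H_{i-1}\otimes\cdots\otimes H_1\otimes F_0^{\otimes l_i}\big)\Delta^{(i+\sum l_t)}$$ (where here $F_t:T^c(S\mathcal A)\to S\mathcal B$ is attached to $f_t$), with, for $i=1$, the additional term $-(-1)^{|H_1|}H_1\circ b$. $Z^0\mathrm{Hom}(f,g)$ is the space of degree $0$ cycles for $m_1$. An element $H\in Z^0\mathrm{Hom}_{\mathrm{Nunc}_\infty}(f,g)$ is a weak equivalence if its class is an isomorphism in $H^0\mathrm{Nunc}_\infty(\mathcal A,\mathcal B)$; for a strictly unital functor $f$, the identity of $f$ in $H^0\mathrm{Nunc}_\infty(\mathcal A,\mathcal B)$ is the class of the element with $h_A=\mathrm{id}_{\dot fA}$ and all higher components zero. *)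

(* Defs.v *)
From HB Require Import structures.
From mathcomp Require Import all_boot all_order all_algebra.
From mathcomp Require Import boolp.

Set Implicit Arguments.
Unset Strict Implicit.
Unset Printing Implicit Defensive.

Import GRing.Theory.
Local Open Scope ring_scope.

(* A chain from X to Z in a quiver Q on O is a composable word               *)
(*   x_n, ..., x_1  with  x_i : Q A_(i-1) A_i,  A_0 = X,  A_n = Z,            *)
(* written, as in A(A_(n-1), A_n) (x) ... (x) A(A_0, A_1), with the last      *)
(* arrow x_n at the head.  It stands for the tensor x_n (x) ... (x) x_1; the  *)
(* empty chain at X stands for id_X in e_O.                                   *)

Section Chains.
Variables (O : Type) (Q : O -> O -> Type).

Inductive chain (X : O) : O -> Type :=
| cnil : chain X X
| ccons Y Z of Q Y Z & chain X Y : chain X Z.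

Fixpoint ccat X Y Z (l : chain Y Z) : chain X Y -> chain X Z :=
  match l in chain _ Z0 return chain X Y -> chain X Z0 with
  | cnil => id
  | ccons _ _ x l' => fun r => ccons x (ccat l' r)
  end.

Fixpoint csize X Z (p : chain X Z) : nat :=
  if p is ccons _ _ _ p' then (csize p').+1 else 0%N.

Lemma ccatA X Y Y' Z (l : chain Y' Z) (m : chain Y Y') (r : chain X Y) :
  ccat l (ccat m r) = ccat (ccat l m) r.
Proof. by elim: l m r => //= U V x l IH m r; rewrite IH. Qed.

Definition csing X Z (x : Q X Z) : chain X Z := ccons x (cnil X).

Record cut X Z := Cut { cutm : O; cutl : chain cutm Z; cutr : chain X cutm }.

(* deconcatenation: all ways of writing p = l ++ r *)
Fixpoint cuts X Z (p : chain X Z) : seq (cut X Z) :=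
  match p in chain _ Z0 return seq (cut X Z0) with
  | cnil => [:: Cut (cnil X) (cnil X)]
  | ccons _ Z x p' =>
      Cut (cnil Z) (ccons x p') ::
      [seq Cut (ccons x (cutl c)) (cutr c) | c <- cuts p']
  end.

Record cut3 X Z := Cut3 {
  cut3m1 : O; cut3m2 : O;
  cut3l : chain cut3m2 Z; cut3m : chain cut3m1 cut3m2; cut3r : chain X cut3m1 }.

(* all ways of writing p = l ++ m ++ r *)
Definition cuts3 X Z (p : chain X Z) : seq (cut3 X Z) :=
  [seq Cut3 (cutl c) (cutl d) (cutr d) | c <- cuts p, d <- cuts (cutr c)].

Lemma big_cuts_ccat (W : nmodType) X Y Y' Z
    (Psi : forall U, chain U Z -> chain X U -> W)
    (l : chain Y' Z) (x : Q Y Y') (r : chain X Y) :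
  \sum_(c <- cuts (ccat l (ccons x r))) Psi (cutm c) (cutl c) (cutr c) =
  \sum_(c <- cuts l) Psi (cutm c) (cutl c) (ccat (cutr c) (ccons x r)) +
  \sum_(c <- cuts r) Psi (cutm c) (ccat l (ccons x (cutl c))) (cutr c).
Proof.
elim: l Psi x => [|U V z l IH] Psi x /=.
  by rewrite big_cons big_seq1 big_map.
rewrite !big_cons !big_map /=.
by rewrite (IH (fun T a b => Psi T (ccons z a) b)) addrA.
Qed.

End Chains.

Arguments cnil {O Q} X.

Section Parts.
Variables (O : Type) (Q : O -> O -> Type).

Definition glue X Y Z (x : Q Y Z) (d : chain (chain Q) X Y) :
    seq (chain (chain Q) X Z) :=
  match d in chain _ _ Y0 return Q Y0 Z -> seq (chain (chain Q) X Z) with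
  | cnil => fun=> [::]
  | ccons _ _ y d' => fun x => [:: ccons (ccons x y) d']
  end x.

(* all ways of cutting p into nonempty consecutive pieces *)
Fixpoint parts X Z (p : chain Q X Z) : seq (chain (chain Q) X Z) :=
  match p in chain _ _ Z0 return seq (chain (chain Q) X Z0) with
  | cnil => [:: cnil X]
  | ccons _ _ x p' =>
      flatten [seq ccons (csing x) d :: glue x d | d <- parts p']
  end.

End Parts.

Fixpoint cmap O O' (Q : O -> O -> Type) (Q' : O' -> O' -> Type) (phi : O -> O')
    (F : forall X Y, Q X Y -> Q' (phi X) (phi Y)) X Z (p : chain Q X Z) :
    chain Q' (phi X) (phi Z) :=
  match p in chain _ _ Z0 return chain Q' (phi X) (phi Z0) with
  | cnil => cnil (phi X)
  | ccons _ _ x p' => ccons (F _ _ x) (cmap F p')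
  end.

(* Homogeneous elements of a graded space V are pairs (d, v) with v : V d. *)
Section Homogeneous.
Variables (K : fieldType) (V : int -> lmodType K).

Definition helt := {d : int & V d}.

Definition hom_elt d (v : V d) : helt := Tagged V v.

(* the component of degree e: v itself if u = (e, v), and 0 if the degree of  *)
(* u is not e; used to add elements whose degrees are only provably equal     *)
Definition at_deg (e : int) (u : helt) : V e :=
  @untag int V (V e) 0 e id u.

Definition hscale (k : K) (u : helt) : helt := hom_elt (k *: tagged u).

Lemma at_deg_hom_elt e d (v : forall d, V d) :
  at_deg e (hom_elt (v d)) = if d == e then v e else 0.
Proof.
rewrite /at_deg /untag /=; case: eqP => [E|]; last by [].
by case: e / E.
Qed.

Lemma at_deg_id d (v : V d) : at_deg d (hom_elt v) = v.
Proof.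
rewrite /at_deg /untag /=; case: eqP => [E|//].
by rewrite /etagged /= eq_axiomK.
Qed.

Lemma at_deg_neq e d (v : V d) : d != e -> at_deg e (hom_elt v) = 0.
Proof. by rewrite /at_deg /untag /=; case: eqP. Qed.

Lemma at_deg0 e d : at_deg e (hom_elt (0 : V d)) = 0.
Proof.
by have [<-|/at_deg_neq->] := eqVneq d e; rewrite ?at_deg_id.
Qed.

Lemma at_degD e d (a : K) (x y : V d) :
  at_deg e (hom_elt (a *: x + y)) =
    a *: at_deg e (hom_elt x) + at_deg e (hom_elt y).
Proof.
have [<-|ne] := eqVneq d e; first by rewrite !at_deg_id.
by rewrite !at_deg_neq // scaler0 addr0.
Qed.

Lemma at_deg_scale e k u : at_deg e (hscale k u) = k *: at_deg e u.
Proof.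
case: u => d v; rewrite /hscale /= -[k *: v]addr0 at_degD at_deg0 addr0.
by [].
Qed.

Lemma hom_elt_at_deg e u : tag u = e -> hom_elt (at_deg e u) = u.
Proof. by case: u => d v /= <-; rewrite at_deg_id. Qed.

End Homogeneous.

Record gquiver (K : fieldType) := GQuiver {
  obj :> Type;
  gr_hom : obj -> obj -> int -> lmodType K }.

Arguments gr_hom {K} g X Y d.

Section GradedQuiver.
Variables (K : fieldType) (V : gquiver K).

Definition edge (X Y : V) := helt (gr_hom V X Y).
Definition gchain := chain edge.

Fixpoint deg X Z (p : gchain X Z) : int :=
  if p is ccons _ _ x p' then tag x + deg p' else 0.

(* The suspension SV is represented by V itself: sx, of degree |x| - 1, is    *)
(* represented by x.  So sdeg p is the degree of sx_n (x) ... (x) sx_1.       *)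
Definition sdeg X Z (p : gchain X Z) : int := deg p - (csize p)%:Z.

(* omega^(x)n (sx_n (x) ... (x) sx_1) = (omega_sign p) x_n (x) ... (x) x_1:   *)
(* omega has degree 1, and the factor sx_i passes i - 1 copies of it          *)
Fixpoint omega_sign X Z (p : gchain X Z) : K :=
  if p is ccons _ _ x p' then
    (-1) ^ ((tag x - 1) * (csize p')%:Z) * omega_sign p'
  else 1.

Definition mlin_at (W : lmodType K) X Z (Phi : gchain X Z -> W) : Prop :=
  forall Y Y' (l : gchain Y' Z) (r : gchain X Y) d (k : K)
    (x y : gr_hom V Y Y' d),
  Phi (ccat l (ccons (hom_elt (k *: x + y)) r)) =
    k *: Phi (ccat l (ccons (hom_elt x) r)) +
    Phi (ccat l (ccons (hom_elt y) r)).

Definition shape_inv (T : Type) X Z (h : gchain X Z -> T) : Prop :=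
  forall Y Y' (l : gchain Y' Z) (r : gchain X Y) d (x y : gr_hom V Y Y' d),
  h (ccat l (ccons (hom_elt x) r)) = h (ccat l (ccons (hom_elt y) r)).

Lemma csize_inv X Z : shape_inv (@csize V edge X Z).
Proof.
by move=> Y Y' l r d x y; elim: l x y => //= U T z l IH x y; rewrite (IH x y).
Qed.

Lemma deg_inv X Z : shape_inv (@deg X Z).
Proof.
by move=> Y Y' l r d x y; elim: l x y => //= U T z l IH x y; rewrite (IH x y).
Qed.

Lemma sdeg_inv X Z : shape_inv (@sdeg X Z).
Proof.
by move=> Y Y' l r d x y; rewrite /sdeg (deg_inv l r x y) (csize_inv l r x y).
Qed.

Lemma omega_sign_inv X Z : shape_inv (@omega_sign X Z).
Proof.
move=> Y Y' l r d x y; elim: l x y => //= U T z l IH x y.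
by rewrite (IH x y) (csize_inv l r x y).
Qed.

Section Mlin.
Variable W : lmodType K.

Lemma mlin_ext X Z (Phi Psi : gchain X Z -> W) :
  Phi =1 Psi -> mlin_at Psi -> mlin_at Phi.
Proof. by move=> E h Y Y' l r d k x y; rewrite !E h. Qed.

Lemma mlin_0 X Z : mlin_at (fun _ : gchain X Z => 0 : W).
Proof. by move=> Y Y' l r d k x y; rewrite scaler0 addr0. Qed.

Lemma mlin_add X Z (Phi Psi : gchain X Z -> W) :
  mlin_at Phi -> mlin_at Psi -> mlin_at (fun p => Phi p + Psi p).
Proof.
by move=> h h' Y Y' l r d k x y; rewrite h h' scalerDr addrACA.
Qed.

Lemma mlin_scale X Z (a : gchain X Z -> K) (Phi : gchain X Z -> W) :
  shape_inv a -> mlin_at Phi -> mlin_at (fun p => a p *: Phi p).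
Proof.
move=> ha h Y Y' l r d k x y; rewrite h (ha _ _ l r d (k *: x + y) y).
by rewrite (ha _ _ l r d x y) scalerDr !scalerA mulrC.
Qed.

Lemma mlin_if X Z (a : gchain X Z -> bool) (Phi : gchain X Z -> W) :
  shape_inv a -> mlin_at Phi -> mlin_at (fun p => if a p then Phi p else 0).
Proof.
move=> ha h Y Y' l r d k x y; rewrite h (ha _ _ l r d (k *: x + y) y).
by rewrite (ha _ _ l r d x y); case: ifP; rewrite ?scaler0 ?addr0.
Qed.

Lemma mlin_sum X Z (I : Type) (s : seq I) (Phi : I -> gchain X Z -> W) :
  (forall i, mlin_at (Phi i)) -> mlin_at (fun p => \sum_(i <- s) Phi i p).
Proof.
move=> h; elim: s => [|i s IH].
  by apply: (mlin_ext _ (@mlin_0 X Z)) => p; rewrite big_nil.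
apply: (mlin_ext _ (mlin_add (h i) IH)) => p.
by rewrite big_cons.
Qed.

Lemma mlin_ccatl X Y Z (s : gchain X Y) (Phi : gchain X Z -> W) :
  mlin_at Phi -> mlin_at (fun p => Phi (ccat p s)).
Proof. by move=> h U U' l r d k x y; rewrite -!ccatA /= h. Qed.

Lemma mlin_ccatr X Y Z (s : gchain Y Z) (Phi : gchain X Z -> W) :
  mlin_at Phi -> mlin_at (fun p => Phi (ccat s p)).
Proof. by move=> h U U' l r d k x y; rewrite !ccatA h. Qed.

Lemma mlin_ccons X Y Z (z : edge Y Z) (Phi : gchain X Z -> W) :
  mlin_at Phi -> mlin_at (fun p => Phi (ccons z p)).
Proof. exact: (@mlin_ccatr X Y Z (csing z)). Qed.

Lemma mlin_cuts X Z (Psi : forall U, gchain U Z -> gchain X U -> W) :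
  (forall U r, mlin_at (fun l => Psi U l r)) ->
  (forall U l, mlin_at (Psi U l)) ->
  mlin_at (fun p => \sum_(c <- cuts p) Psi (cutm c) (cutl c) (cutr c)).
Proof.
move=> hl hr Y Y' l r d k x y; rewrite !big_cuts_ccat.
rewrite scalerDr addrACA !scaler_sumr -!big_split /=.
congr (_ + _); apply: eq_bigr => c _; first exact: hr.
exact: (hl _ (cutr c) _ _ l (cutl c)).
Qed.

Lemma mlin_cuts3 X Z
    (Psi : forall U U', gchain U' Z -> gchain U U' -> gchain X U -> W) :
  (forall U U' m r, mlin_at (fun l => Psi U U' l m r)) ->
  (forall U U' l r, mlin_at (fun m => Psi U U' l m r)) ->
  (forall U U' l m, mlin_at (Psi U U' l m)) ->
  mlin_at (fun p => \sum_(c <- cuts3 p)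
    Psi (cut3m1 c) (cut3m2 c) (cut3l c) (cut3m c) (cut3r c)).
Proof.
move=> hl hm hr.
apply: (mlin_ext (Psi := fun p => \sum_(c <- cuts p) \sum_(d <- cuts (cutr c))
  Psi (cutm d) (cutm c) (cutl c) (cutl d) (cutr d))).
  by move=> p; rewrite /cuts3 big_allpairs_dep.
apply: (mlin_cuts (Psi := fun U' l q => \sum_(d <- cuts q)
  Psi (cutm d) U' l (cutl d) (cutr d))) => [U r | U l].
  by apply: mlin_sum => d; apply: hl.
apply: (mlin_cuts (Psi := fun T m r => Psi T U l m r)) => [T r | T m].
  exact: hm.
exact: hr.
Qed.

Definition mlin2 X Z (Phi : chain gchain X Z -> W) : Prop :=
  forall Y Y' (D1 : chain gchain Y' Z) (D2 : chain gchain X Y),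
  mlin_at (fun p : gchain Y Y' => Phi (ccat D1 (ccons p D2))).

Lemma mlin_parts X Z (Phi : chain gchain X Z -> W) :
  mlin2 Phi -> mlin_at (fun p => \sum_(d <- parts p) Phi d).
Proof.
have step : forall X Y Z (x : edge Y Z) (Phi : chain gchain X Z -> W) p,
    \sum_(d <- parts (ccons x p)) Phi d =
    \sum_(d <- parts p) (Phi (ccons (csing x) d) +
      \sum_(d' <- glue x d) Phi d').
  move=> {}X Y {}Z x {}Phi p /=; rewrite big_flatten big_map.
  by apply: eq_bigr => d _; rewrite big_cons.
move=> h Y Y' l r e k x y.
elim: l Phi h x y => [|U T z l IH] Phi h x y.
  rewrite /ccat !step scaler_sumr -big_split /=; apply: eq_bigr => d _.
  rewrite (h _ _ (cnil _) d _ _ (cnil _) (cnil _)) scalerDr addrACA.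
  congr (_ + _); case: d x y => [|S S' q d] x y /=.
    by rewrite !big_nil scaler0 addr0.
  by rewrite !big_seq1 (h _ _ (cnil _) d _ _ (cnil _) q).
rewrite -![ccat (ccons z l) _]/(ccons z (ccat l _)) !step.
apply: (IH (fun d => Phi (ccons (csing z) d) + \sum_(d' <- glue z d) Phi d')).
move=> S S' D1 D2.
apply: mlin_add; first exact: (h _ _ (ccons (csing z) D1) D2).
case: D1 z h {IH step} => [|R R' q D1] z h /=.
  apply: (mlin_ext (Psi := fun p => Phi (ccons (ccons z p) D2))).
    by move=> p; rewrite big_seq1.
  exact: (mlin_ccons (Phi := fun p => Phi (ccons p D2)) z (h _ _ (cnil _) D2)).
apply: (mlin_ext (Psi := fun p =>
    Phi (ccat (ccons (ccons z q) D1) (ccons p D2)))).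
  by move=> p; rewrite big_seq1.
exact: h.
Qed.

End Mlin.

End GradedQuiver.

Arguments gchain {K} V X Z.

Definition multilinear (K : fieldType) (V W : gquiver K) (phi psi : V -> W)
    (Phi : forall X Z, gchain V X Z -> edge (phi X) (psi Z)) : Prop :=
  forall X Z e, mlin_at (fun p => at_deg e (Phi X Z p)).

(* The operations of an A_oo-category, without its axioms. *)
Record ainf_ops (K : fieldType) := AinfOps {
  ops_quiver :> gquiver K;
  mop : forall X Z (p : gchain ops_quiver X Z),
    gr_hom ops_quiver X Z (deg p + (2 - (csize p)%:Z)) }.

Arguments mop {K} a {X Z} p.

Section Ops.
Variables (K : fieldType) (D : ainf_ops K).

Definition mh X Z (p : gchain D X Z) : edge X Z := hom_elt (mop D p).

(* b_n = - s m_n omega^(x)n *)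
Definition bh X Z (p : gchain D X Z) : edge X Z :=
  hscale (- omega_sign p) (mh p).

(* The differential of T^c(SD) on the tensor p, as a formal sum of signed     *)
(* chains: the terms of sum (1^(x)j (x) b_k (x) 1^(x)l)(p), k >= 1, with the  *)
(* Koszul sign for b, of degree 1, passing the first j factors.               *)
Definition bhat X Z (p : gchain D X Z) : seq (K * gchain D X Z) :=
  [seq ((-1) ^ sdeg (cut3l c), ccat (cut3l c) (ccons (bh (cut3m c)) (cut3r c)))
  | c <- cuts3 p & csize (cut3m c) != 0%N].

(* (-1)^(jk+l) from the A_oo-relation, and (-1)^((2-k) deg) from evaluating   *)
(* 1^(x)j (x) m_k (x) 1^(x)l, m_k having degree 2 - k                         *)
Definition stasheff_sign X Z (c : cut3 (@edge K D) X Z) : K :=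
  let j := csize (cut3l c) in
  let k := csize (cut3m c) in
  let l := csize (cut3r c) in
  (-1) ^+ (j * k + l) * (-1) ^ ((2 - k%:Z) * deg (cut3l c)).

Definition stasheff : Prop :=
  forall X Z (p : gchain D X Z),
    \sum_(c <- cuts3 p | csize (cut3m c) != 0%N)
      stasheff_sign c *:
        at_deg (deg p + (3 - (csize p)%:Z))
          (mh (ccat (cut3l c) (ccons (mh (cut3m c)) (cut3r c)))) = 0.

Definition strictly_unital (one : forall X : D, gr_hom D X X 0) : Prop :=
  [/\ forall X Z (x : edge X Z), mh (ccons (hom_elt (one Z)) (csing x)) = x,
      forall X Z (x : edge X Z), mh (ccons x (csing (hom_elt (one X)))) = x &
      forall X Y Z (l : gchain D Y Z) (r : gchain D X Y),
        (csize l + csize r != 1)%N ->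
        mop D (ccat l (ccons (hom_elt (one Y)) r)) = 0].

End Ops.

(* m_n exists for n >= 1 only: mop on an empty chain is set to 0, which also  *)
(* makes b vanish on the summand i = 0 of T^c.                                *)
Record ainf_cat (K : fieldType) := AinfCat {
  cat_ops :> ainf_ops K;
  mop_nil : forall X, mop cat_ops (cnil X) = 0;
  mop_lin : multilinear (@mh K cat_ops);
  mop_rel : stasheff cat_ops }.

Lemma mlin_plug (K : fieldType) (V V' : gquiver K) (W : lmodType K) (X Z : V)
    (S S' T T' : V') (l : gchain V' S' T') (r : gchain V' T S)
    (U : gchain V X Z -> edge S S') (Phi : gchain V' T T' -> W) :
  shape_inv (fun p => tag (U p)) ->
  (forall e, mlin_at (fun p => at_deg e (U p))) ->
  mlin_at Phi -> mlin_at (fun p => Phi (ccat l (ccons (U p) r))).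
Proof.
move=> ht hU h Y Y' l' r' d k x y.
set px := ccat l' (ccons (hom_elt x) r').
set py := ccat l' (ccons (hom_elt y) r').
set pz := ccat l' (ccons (hom_elt (k *: x + y)) r').
rewrite -(hom_elt_at_deg (erefl (tag (U pz)))).
rewrite -(hom_elt_at_deg (ht _ _ l' r' d x (k *: x + y))).
rewrite -(hom_elt_at_deg (ht _ _ l' r' d y (k *: x + y))).
by rewrite hU h.
Qed.

Section BLin.
Variables (K : fieldType) (D : ainf_cat K) (W : lmodType K).

Lemma tag_bh_inv X Z : shape_inv (fun p : gchain D X Z => tag (bh p)).
Proof.
by move=> Y Y' l r d x y /=; rewrite (deg_inv l r x y) (csize_inv l r x y).
Qed.

Lemma bh_lin X Z e : mlin_at (fun p : gchain D X Z => at_deg e (bh p)).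
Proof.
apply: (mlin_ext (Psi := fun p : gchain D X Z =>
    (- omega_sign p) *: at_deg e (mh p))).
  by move=> p; rewrite at_deg_scale.
apply: mlin_scale => [Y Y' l r d x y|]; last exact: mop_lin.
by rewrite (omega_sign_inv l r x y).
Qed.

Lemma bhat_lin X Z (Phi : gchain D X Z -> W) :
  mlin_at Phi -> mlin_at (fun p => \sum_(t <- bhat p) t.1 *: Phi t.2).
Proof.
move=> h; pose Psi U U' (l : gchain D U' Z) (m : gchain D U U') r :=
  if csize m != 0%N then (-1) ^ sdeg l *: Phi (ccat l (ccons (bh m) r)) else 0.
apply: (mlin_ext (Psi := fun p => \sum_(c <- cuts3 p)
    Psi _ _ (cut3l c) (cut3m c) (cut3r c))).
  by move=> p; rewrite big_map big_filter big_mkcond.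
apply: mlin_cuts3 => U U'.
- move=> m r; apply: mlin_if; first by [].
  apply: mlin_scale; last exact: mlin_ccatl.
  by move=> Y Y' l r' d x y; rewrite (sdeg_inv l r' x y).
- move=> l r; apply: mlin_if.
    by move=> Y Y' l' r' d x y; rewrite (csize_inv l' r' x y).
  apply: mlin_scale; first by [].
  apply: mlin_plug => //; [exact: tag_bh_inv | exact: bh_lin].
move=> l m; apply: mlin_if; first by [].
apply: mlin_scale; first by [].
apply: (mlin_ccons (Phi := fun q => Phi (ccat l q)) (bh m)); exact: mlin_ccatr.
Qed.

End BLin.


Section Functors.
Variables (K : fieldType) (A B : ainf_cat K).

Section Components.
Variables (phi : A -> B).
Variable fmor : forall X Z (p : gchain A X Z),
  gr_hom B (phi X) (phi Z) (deg p + (1 - (csize p)%:Z)).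

Definition fh_of X Z (p : gchain A X Z) : edge (phi X) (phi Z) :=
  hom_elt (fmor p).

(* F_n = s f_n omega^(x)n *)
Definition Fh_of X Z (p : gchain A X Z) : edge (phi X) (phi Z) :=
  hscale (omega_sign p) (fh_of p).

(* The coalgebra map with components F_n on the tensor p, as a formal sum of  *)
(* chains: the terms of sum_l F^(x)l Delta^(l) (p).  Since F vanishes on the  *)
(* empty chain only cuts into nonempty pieces occur; F has degree 0, hence no *)
(* signs.                                                                     *)
Definition Fhat_of X Z (p : gchain A X Z) : seq (gchain B (phi X) (phi Z)) :=
  [seq cmap Fh_of d | d <- parts p].

End Components.

(* f_rel: the coalgebra map commutes with the differentials, i.e.             *)
(*   sum b_l (F (x) ... (x) F) = sum F (1^(x)j (x) b_k (x) 1^(x)l).           *)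
Record ainf_functor := AinfFunctor {
  fobj :> A -> B;
  fmor : forall X Z (p : gchain A X Z),
    gr_hom B (fobj X) (fobj Z) (deg p + (1 - (csize p)%:Z));
  fmor_nil : forall X, fmor (cnil X) = 0;
  fmor_lin : multilinear (fh_of fmor);
  fmor_rel : forall X Z (p : gchain A X Z),
    \sum_(q <- Fhat_of fmor p) at_deg (sdeg p + 2) (bh q) =
    \sum_(t <- bhat p) t.1 *: at_deg (sdeg p + 2) (Fh_of fmor t.2) }.

Definition fh (f : ainf_functor) X Z (p : gchain A X Z) : edge (f X) (f Z) :=
  fh_of (@fmor f) p.

Definition Fhat (f : ainf_functor) X Z (p : gchain A X Z) :
    seq (gchain B (f X) (f Z)) :=
  Fhat_of (@fmor f) p.

Definition strictly_unital_functor (oneA : forall X : A, gr_hom A X X 0)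
    (oneB : forall X : B, gr_hom B X X 0) (f : ainf_functor) : Prop :=
  (forall X, fh f (csing (hom_elt (oneA X))) = hom_elt (oneB (f X))) /\
  (forall X Y Z (l : gchain A Y Z) (r : gchain A X Y),
     (csize l + csize r != 0)%N ->
     fmor f (ccat l (ccons (hom_elt (oneA Y)) r)) = 0).

(* Graded maps T^c(SA)(X, Z) -> B(f X, g Z) of degree d. *)
Record cochain (f g : ainf_functor) (d : int) := Cochain {
  cochain_val :> forall X Z (p : gchain A X Z),
    gr_hom B (f X) (g Z) (sdeg p + d);
  cochain_lin : multilinear (fun (X Z : A) (p : gchain A X Z) =>
    hom_elt (cochain_val p)) }.



Section CochainModule.
Variables (f g : ainf_functor) (d : int).
Implicit Types H : cochain f g d.

Lemma cochain_ext H1 H2 :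
  (forall X Z (p : gchain A X Z), H1 X Z p = H2 X Z p) -> H1 = H2.
Proof.
case: H1 H2 => [u hu] [v hv] /= uv.
suff E : u = v by subst v; rewrite (Prop_irrelevance hu hv).
by do 3!apply: functional_extensionality_dep => ?; apply: uv.
Qed.

Fact cochain_lin_zero : multilinear (fun (X Z : A) (p : gchain A X Z) =>
  hom_elt (0 : gr_hom B (f X) (g Z) (sdeg p + d))).
Proof.
by move=> X Z e Y Y' l r c k x y; rewrite !at_deg0 scaler0 addr0.
Qed.

Fact cochain_lin_comb (a : K) H1 H2 :
  multilinear (fun (X Z : A) (p : gchain A X Z) =>
    hom_elt (a *: H1 X Z p + H2 X Z p)).
Proof.
move=> X Z e Y Y' l r c k x y; rewrite !at_degD.
have := cochain_lin H1 e l r k x y; have := cochain_lin H2 e l r k x y.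
move=> /= -> ->.
by rewrite !scalerDr !scalerA [a * k]mulrC addrACA.
Qed.

Definition cochain_zero : cochain f g d :=
  @Cochain f g d (fun X Z p => 0) cochain_lin_zero.
Definition cochain_comb a H1 H2 : cochain f g d :=
  @Cochain f g d (fun X Z p => a *: H1 X Z p + H2 X Z p)
    (cochain_lin_comb a H1 H2).
Definition cochain_add H1 H2 := cochain_comb 1 H1 H2.
Definition cochain_opp H := cochain_comb (-1) H cochain_zero.
Definition cochain_scale a H := cochain_comb a H cochain_zero.

Fact cochain_addA : associative cochain_add.
Proof. by move=> ? ? ?; apply: cochain_ext => *; rewrite /= !scale1r addrA. Qed.

Fact cochain_addC : commutative cochain_add.
Proof.
by move=> ? ?; apply: cochain_ext => *; rewrite /= !scale1r; apply: addrC.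
Qed.

Fact cochain_add0 : left_id cochain_zero cochain_add.
Proof. by move=> ?; apply: cochain_ext => *; rewrite /= scaler0 add0r. Qed.

Fact cochain_addN : left_inverse cochain_zero cochain_opp cochain_add.
Proof.
move=> ?; apply: cochain_ext => *.
by rewrite /= addr0 scale1r scaleN1r addNr.
Qed.

HB.instance Definition _ := gen_eqMixin (cochain f g d).
HB.instance Definition _ := gen_choiceMixin (cochain f g d).
HB.instance Definition _ := GRing.isZmodule.Build (cochain f g d)
  cochain_addA cochain_addC cochain_add0 cochain_addN.

Fact cochain_scaleA a b H :
  cochain_scale a (cochain_scale b H) = cochain_scale (a * b) H.
Proof. by apply: cochain_ext => *; rewrite /= !addr0 scalerA. Qed.

Fact cochain_scale1 : left_id 1 cochain_scale.
Proof. by move=> ?; apply: cochain_ext => *; rewrite /= addr0 scale1r. Qed.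

Fact cochain_scaleDr : right_distributive cochain_scale +%R.
Proof.
move=> ? ? ?; apply: cochain_ext => *.
by rewrite /= !addr0 !scale1r scalerDr.
Qed.

Fact cochain_scaleDl H : {morph cochain_scale^~ H : a b / a + b}.
Proof.
move=> ? ?; apply: cochain_ext => *.
by rewrite /= !addr0 !scale1r scalerDl.
Qed.

HB.instance Definition _ := GRing.Zmodule_isLmodule.Build K (cochain f g d)
  cochain_scaleA cochain_scale1 cochain_scaleDr cochain_scaleDl.

End CochainModule.

Definition nunc_quiver : gquiver K :=
  @GQuiver K ainf_functor (fun f g d => cochain f g d : lmodType K).

Definition cochain_app (f g : nunc_quiver) (H : edge f g) X Z
    (p : gchain A X Z) : edge (f X) (g Z) :=
  hom_elt (tagged H X Z p).

(* For H_i, ..., H_1 with H_t : f_(t-1) -> f_t, the tensor                    *)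
(*   sum_l (F_i^(x)l_0 (x) H_i (x) F_(i-1)^(x)l_1 (x) ... (x) H_1 (x)         *)
(*          F_0^(x)l_i) Delta (p)                                             *)
(* of T^c(SB) as a formal sum of signed chains.  Each H_t stands for s H_t,   *)
(* of degree |H_t| - 1; the sign is that of H_i passing the chain to its left *)
(* and of H_(i-1), ..., H_1 passing the chains under F_i^(x)l_0 and H_i.      *)
Fixpoint mix (f g : nunc_quiver) (Hs : gchain nunc_quiver f g) :
    forall X Z, gchain A X Z -> seq (K * gchain B (f X) (g Z)) :=
  match Hs in chain _ _ g0
    return forall X Z, gchain A X Z -> seq (K * gchain B (f X) (g0 Z)) with
  | cnil => fun X Z p => [seq (1, q) | q <- Fhat f p]
  | ccons f' g0 H Hs' => fun X Z p =>
      flatten [seq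
        [seq ((-1) ^ ((tag H - 1) * sdeg (cut3l c)
                 + sdeg Hs' * (sdeg (cut3l c) + sdeg (cut3m c))) * t.1,
              ccat q (ccons (cochain_app H (cut3m c)) t.2))
        | q <- Fhat g0 (cut3l c), t <- mix Hs' (cut3r c)]
      | c <- cuts3 p]
  end.

(* the additional term -(-1)^|sH| (sH o b) of b_1, and 0 for i != 1 *)
Definition nunc_b1_extra (f g : nunc_quiver) (Hs : gchain nunc_quiver f g)
    X Z (p : gchain A X Z) (e : int) : gr_hom B (f X) (g Z) e :=
  match Hs in chain _ _ g0 return gr_hom B (f X) (g0 Z) e with
  | ccons f' g0 H Hs' =>
      match Hs' in chain _ _ f1 return
          edge f1 g0 -> gr_hom B (f X) (g0 Z) e with
      | cnil => fun H => - (-1) ^ (tag H - 1) *: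
          \sum_(t <- bhat p) t.1 *: at_deg e (cochain_app H t.2)
      | ccons _ _ _ _ => fun=> 0
      end H
  | cnil => 0
  end.

(* b_i(H_i (x) ... (x) H_1) evaluated at p, in degree e *)
Definition nunc_b (f g : nunc_quiver) (Hs : gchain nunc_quiver f g)
    X Z (p : gchain A X Z) (e : int) : gr_hom B (f X) (g Z) e :=
  \sum_(t <- mix Hs p) t.1 *: at_deg e (bh t.2) + nunc_b1_extra Hs p e.

(* m_i(H_i, ..., H_1), recovered from                                         *)
(*   b_i(sH_i (x) ... (x) sH_1) = - s m_i omega^(x)i (sH_i (x) ... (x) sH_1); *)
(* for i = 0 it is set to 0                                                   *)
Definition nunc_val (f g : nunc_quiver) (Hs : gchain nunc_quiver f g)
    X Z (p : gchain A X Z) (e : int) : gr_hom B (f X) (g Z) e :=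
  if csize Hs == 0%N then 0 else - omega_sign Hs *: nunc_b Hs p e.

Section NuncLin.
Variable W : lmodType K.

Lemma Fhat_lin (f : ainf_functor) X Z (Phi : gchain B (f X) (f Z) -> W) :
  mlin_at Phi -> mlin_at (fun p : gchain A X Z => \sum_(q <- Fhat f p) Phi q).
Proof.
move=> h; apply: (mlin_ext (Psi := fun p : gchain A X Z =>
    \sum_(d <- parts p) Phi (cmap (Fh_of (@fmor f)) d))).
  by move=> p; rewrite big_map.
apply: mlin_parts => Y Y' D1 D2.
apply: (mlin_ext (Psi := fun p => Phi (ccat (cmap (Fh_of (@fmor f)) D1)
    (ccons (Fh_of (@fmor f) p) (cmap (Fh_of (@fmor f)) D2))))).
  move=> p; congr Phi.
  by elim: D1 {h Phi} => //= S S' x D1 IH; rewrite IH.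
apply: mlin_plug h => [U U' l r d x y|e] /=.
  by rewrite (deg_inv l r x y) (csize_inv l r x y).
apply: (mlin_ext (Psi := fun p : gchain A Y Y' =>
    omega_sign p *: at_deg e (fh f p))).
  by move=> p; rewrite at_deg_scale.
by apply: mlin_scale; [exact: omega_sign_inv | exact: fmor_lin].
Qed.

Lemma tag_cochain_app_inv (f g : nunc_quiver) (H : edge f g) (X Z : A) :
  shape_inv (fun p : gchain A X Z => tag (cochain_app H p)).
Proof. by move=> Y Y' l r d x y /=; rewrite (sdeg_inv l r x y). Qed.

Lemma cochain_app_lin (f g : nunc_quiver) (H : edge f g) (X Z : A) e :
  mlin_at (fun p : gchain A X Z => at_deg e (cochain_app H p)).
Proof. exact: (@cochain_lin f g (tag H) (tagged H) X Z e). Qed.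

Lemma mix_lin (f g : nunc_quiver) (Hs : gchain nunc_quiver f g) X Z
    (Phi : gchain B (f X) (g Z) -> W) :
  mlin_at Phi -> mlin_at (fun p => \sum_(t <- mix Hs p) t.1 *: Phi t.2).
Proof.
elim: Hs X Z Phi => [|f' g0 H Hs IH] X Z Phi h.
  apply: mlin_ext (Fhat_lin h) => p /=; rewrite big_map.
  by apply: eq_bigr => q _; rewrite scale1r.
pose Psi U U' (l : gchain A U' Z) (m : gchain A U U') (r : gchain A X U) :=
  (-1) ^ ((tag H - 1) * sdeg l + sdeg Hs * (sdeg l + sdeg m)) *:
  \sum_(q <- Fhat g0 l) \sum_(t <- mix Hs r)
     t.1 *: Phi (ccat q (ccons (cochain_app H m) t.2)).
apply: (mlin_ext (Psi := fun p => \sum_(c <- cuts3 p)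
    Psi _ _ (cut3l c) (cut3m c) (cut3r c))).
  move=> p /=; rewrite big_flatten big_map; apply: eq_bigr => c _.
  rewrite big_allpairs_dep /Psi scaler_sumr; apply: eq_bigr => q _.
  by rewrite scaler_sumr; apply: eq_bigr => t _; rewrite scalerA.
apply: mlin_cuts3 => U U'.
- move=> m r; apply: mlin_scale.
    by move=> Y Y' l r' d x y; rewrite (sdeg_inv l r' x y).
  apply: (Fhat_lin (Phi := fun q => \sum_(t <- mix Hs r)
     t.1 *: Phi (ccat q (ccons (cochain_app H m) t.2)))).
  by apply: mlin_sum => t; apply: mlin_scale; [|exact: mlin_ccatl].
- move=> l r; apply: mlin_scale.
    by move=> Y Y' l' r' d x y; rewrite (sdeg_inv l' r' x y).
  apply: mlin_sum => q; apply: mlin_sum => t; apply: mlin_scale => //.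
  apply: mlin_plug => //; [exact: tag_cochain_app_inv | exact: cochain_app_lin].
move=> l m; apply: mlin_scale => //; apply: mlin_sum => q.
apply: (IH _ _ (fun s => Phi (ccat q (ccons (cochain_app H m) s)))).
apply: (mlin_ccons (Phi := fun s => Phi (ccat q s)) (cochain_app H m)).
exact: mlin_ccatr.
Qed.

End NuncLin.

Lemma nunc_val_lin (f g : nunc_quiver) (Hs : gchain nunc_quiver f g) X Z e :
  mlin_at (fun p : gchain A X Z => nunc_val Hs p e).
Proof.
rewrite /nunc_val; case: (csize Hs == 0%N); first exact: mlin_0.
apply: mlin_scale => //; apply: mlin_add.
  exact: (mix_lin Hs (@bh_lin K B _ _ e)).
case: Hs => [|f' g0 H Hs] /=; first exact: mlin_0.
case: Hs H => [|f1 f2 H1 Hs] H; last exact: mlin_0.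
by apply: mlin_scale => //; exact: (bhat_lin (@cochain_app_lin f g0 H X Z e)).
Qed.

Fact nunc_mop_lin (f g : nunc_quiver) (Hs : gchain nunc_quiver f g) :
  multilinear (fun (X Z : A) (p : gchain A X Z) =>
    hom_elt (nunc_val Hs p (sdeg p + (deg Hs + (2 - (csize Hs)%:Z))))).
Proof.
move=> X Z e; set n := deg Hs + _.
apply: (mlin_ext (Psi := fun p : gchain A X Z =>
    if sdeg p + n == e then nunc_val Hs p e else 0)).
  by move=> p; rewrite (at_deg_hom_elt e _ (nunc_val Hs p)).
apply: mlin_if (nunc_val_lin Hs e).
by move=> Y Y' l r d x y; rewrite (sdeg_inv l r x y).
Qed.

Definition nunc_mop (f g : nunc_quiver) (Hs : gchain nunc_quiver f g) :
    gr_hom nunc_quiver f g (deg Hs + (2 - (csize Hs)%:Z)) :=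
  @Cochain f g _
    (fun X Z p => nunc_val Hs p (sdeg p + (deg Hs + (2 - (csize Hs)%:Z))))
    (nunc_mop_lin Hs).

(* The objects are all A_oo-functors A -> B, strictly unital or not. *)
Definition Nunc : ainf_ops K := AinfOps nunc_mop.

(* h_X = oneB (f X), and all higher components are zero *)
Definition nunc_one_val (oneB : forall X : B, gr_hom B X X 0) (f : ainf_functor)
    X Z (p : gchain A X Z) : gr_hom B (f X) (f Z) (sdeg p + 0) :=
  match p in chain _ _ Z0 return gr_hom B (f X) (f Z0) (sdeg p + 0) with
  | cnil => oneB (f X)
  | ccons _ _ _ _ => 0
  end.

Fact nunc_one_lin oneB (f : ainf_functor) :
  multilinear (fun (X Z : A) p => hom_elt (@nunc_one_val oneB f X Z p)).
Proof.
move=> X Z e Y Y' l r d k x y.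
by case: l x y => [|S S' z l] x y /=; rewrite !at_deg0 scaler0 addr0.
Qed.

Definition nunc_one oneB (f : Nunc) : gr_hom Nunc f f 0 :=
  @Cochain f f 0 (nunc_one_val oneB f) (nunc_one_lin oneB f).

End Functors.

Section H0.
Variables (K : fieldType) (D : ainf_ops K).

Definition cycle0 (X Y : D) (x : gr_hom D X Y 0) : Prop :=
  mop D (csing (hom_elt x)) = 0.

(* x and y have the same class in H^0 *)
Definition homologous (X Y : D) (x y : gr_hom D X Y 0) : Prop :=
  exists z : gr_hom D X Y (-1), at_deg 0 (mh (csing (hom_elt z))) = x - y.

Definition comp0 (X Y Z : D) (y : gr_hom D Y Z 0) (x : gr_hom D X Y 0) :
    gr_hom D X Z 0 :=
  at_deg 0 (mh (ccons (hom_elt y) (csing (hom_elt x)))).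

(* x is a cycle whose class is an isomorphism in H^0 D, the identities of     *)
(* H^0 D being the classes of the elements one X                              *)
Definition H0_iso (one : forall X : D, gr_hom D X X 0) (X Y : D)
    (x : gr_hom D X Y 0) : Prop :=
  cycle0 x /\
  exists y : gr_hom D Y X 0,
    [/\ cycle0 y, homologous (comp0 y x) (one X) &
        homologous (comp0 x y) (one Y)].

End H0.

Section NaturalIso.
Variables (K : fieldType) (A B : ainf_cat K).

Definition H0_fun (f : ainf_functor A B) (X Y : A) (x : gr_hom A X Y 0) :
    gr_hom B (f X) (f Y) 0 :=
  at_deg 0 (fh f (csing (hom_elt x))).

(* The classes of the h X are an isomorphism of functors H^0 f -> H^0 g. *)
Definition H0_natural_iso (oneB : forall X : B, gr_hom B X X 0)
    (f g : ainf_functor A B) (h : forall X : A, gr_hom B (f X) (g X) 0) :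
    Prop :=
  [/\ forall X, cycle0 (h X),
      forall (X Y : A) (x : gr_hom A X Y 0), cycle0 x ->
        homologous (comp0 (h Y) (H0_fun f x)) (comp0 (H0_fun g x) (h X)) &
      forall X, H0_iso oneB (h X)].

Definition weak_equivalence (oneB : forall X : B, gr_hom B X X 0)
    (f g : Nunc A B) (H : gr_hom (Nunc A B) f g 0) : Prop :=
  H0_iso (nunc_one oneB) H.

(* h_X = h_0 (id_X); the sign (-1)^|H| is trivial in degree 0 *)
Definition zero_component (f g : ainf_functor A B) (H : gr_hom (Nunc A B) f g 0)
    (X : A) : gr_hom B (f X) (g X) 0 :=
  cochain_val H (cnil X).

End NaturalIso.

(* Main.v *)
Require Import Defs.
From mathcomp Require Import all_boot all_order all_algebra.
From mathcomp Require Import boolp ring zify.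

(** Evaluating cochains on the empty chains is compatible with m_1 and m_2, so
    an inverse of H in H^0 Nunc gives inverses of all h_X in H^0 B
    ([homologous_at_nil]).  Naturality is the equation (m_1 H)(x) = 0 for a
    cycle x : X -> Y: it says that H(x) is a homotopy between h_Y f(x) and
    g(x) h_X ([zero_component_natural]).

    For the converse, filter the cochains by the length of the chains on which
    they vanish.  Inverses y_X of the h_X and the corresponding homotopies,
    extended by zero to chains of positive length, are cochains G0, t, t' that
    satisfy the equations of a homotopy inverse of H up to cochains vanishing
    on the empty chains.  From them one builds a contraction of the cone of
    composition with H : Hom(g, f) -> Hom(g, g), up to terms of higher
    filtration ([estepE], [ustepE]).  The pair (0, id_g) is a cycle of this
    cone.  Subtracting again and again the boundary provided by the
    contraction moves it to ever higher filtration, and the sum of all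
    corrections is finite on every chain; this yields a cycle G with HG
    homotopic to id_g ([right_inverse_exists]).  The components of G are again
    invertible, so G has a right inverse too.  Being a left inverse of G, H
    agrees with it up to homotopy, so G is a two-sided inverse of H.

    This argument computes with b_1, b_2, b_3 of Nunc, so it rests on the
    A_oo-relations of Nunc ([NuncCat]).  They come from a dg coalgebra map.
    Consider pairs (H_i (x) ... (x) H_1, p), i.e. the tensor coalgebra
    T^c(S Nunc) (x) T^c(SA) with its codifferential.  The formal sum [mix] is a
    coalgebra map from it to T^c(SB) ([mix_csum]), whose components ([letter])
    are F_0 on the pairs (1, p) and H_1 on the pairs (H_1, p).  A coalgebra map
    commutes with coderivations as soon as it does after projection to the
    cogenerators, and there the equation is the relation of an A_oo-functor
    for i = 0 and the definition of b_i in Nunc for i > 0 ([mix_cogenerator]).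
    So [mix] commutes with the codifferentials ([mix_bhat]), and the
    vanishing of their squares for A and B implies it for Nunc. *)

Set Implicit Arguments.
Unset Strict Implicit.
Unset Printing Implicit Defensive.
Import GRing.Theory.
Local Open Scope ring_scope.

(** * Formal sums, signs and sums over cuts *)

Section FormalSums.
Variables (K : fieldType) (W : lmodType K).

Definition lcomb (T : Type) (S : seq (K * T)) (Phi : T -> W) : W :=
  \sum_(t <- S) t.1 *: Phi t.2.

Lemma eq_lcomb T (S : seq (K * T)) (Phi Psi : T -> W) :
  Phi =1 Psi -> lcomb S Phi = lcomb S Psi.
Proof. by move=> E; apply: eq_bigr => t _; rewrite E. Qed.

Lemma lcomb0 T (S : seq (K * T)) : lcomb S (fun=> 0) = 0.
Proof. by rewrite /lcomb big1 // => t _; rewrite scaler0. Qed.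

Lemma lcombD T (S : seq (K * T)) (Phi Psi : T -> W) :
  lcomb S (fun t => Phi t + Psi t) = lcomb S Phi + lcomb S Psi.
Proof. by rewrite /lcomb -big_split; apply: eq_bigr => t _; rewrite scalerDr. Qed.

Lemma lcombZ T (S : seq (K * T)) k (Phi : T -> W) :
  lcomb S (fun t => k *: Phi t) = k *: lcomb S Phi.
Proof.
by rewrite /lcomb scaler_sumr; apply: eq_bigr => t _; rewrite !scalerA mulrC.
Qed.

End FormalSums.

Section Signs.
Variable K : fieldType.

Definition sgn (z : int) : K := (-1) ^ z.

Lemma sgnD a b : sgn (a + b) = sgn a * sgn b.
Proof. by rewrite /sgn expfzDr ?oppr_eq0 ?oner_eq0. Qed.

Lemma sgn0 : sgn 0 = 1. Proof. by []. Qed.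
Lemma sgn1 : sgn 1 = -1. Proof. by []. Qed.

Lemma sgn_double a : sgn (a + a) = 1.
Proof. by rewrite sgnD /sgn -expfzMl mulrNN mulr1 exp1rz. Qed.

Lemma sgn_sqr a : sgn a * sgn a = 1.
Proof. by rewrite -sgnD sgn_double. Qed.

(** Exponents of the same parity; the witness c is left to the caller, so that
    the equation between the exponents can be proved by [ring]. *)
Lemma eq_sgn c a b : a = b + (c + c) -> sgn a = sgn b.
Proof. by move=> ->; rewrite sgnD sgn_double mulr1. Qed.

Lemma sgnN1 : sgn (-1) = -1.
Proof. by rewrite (@eq_sgn (-1) (-1) 1). Qed.

End Signs.
Arguments sgn {K} z.

Section CutSums.
Variables (O : Type) (Q : O -> O -> Type).

Section Basic.
Variable W : nmodType.

(** The deconcatenation Delta(p), seen through a functional Psi.  All identities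
    between formal sums of chains below are stated through functionals, which
    avoids a quotient imposing linearity. *)
Definition csum X Z (p : chain Q X Z)
    (Psi : forall U, chain Q U Z -> chain Q X U -> W) : W :=
  \sum_(c <- cuts p) Psi (cutm c) (cutl c) (cutr c).

Lemma csum_nil X (Psi : forall U, chain Q U X -> chain Q X U -> W) :
  csum (cnil X) Psi = Psi X (cnil X) (cnil X).
Proof. by rewrite /csum big_seq1. Qed.

Lemma csum_cons X Y Z (x : Q Y Z) (p : chain Q X Y)
    (Psi : forall U, chain Q U Z -> chain Q X U -> W) :
  csum (ccons x p) Psi =
    Psi Z (cnil Z) (ccons x p) + csum p (fun U l r => Psi U (ccons x l) r).
Proof. by rewrite /csum big_cons big_map. Qed.

Lemma eq_csum X Z (p : chain Q X Z)
    (Phi Psi : forall U, chain Q U Z -> chain Q X U -> W) :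
  (forall U l r, ccat l r = p -> Phi U l r = Psi U l r) ->
  csum p Phi = csum p Psi.
Proof.
elim: p Phi Psi => [|Y {}Z x p IH] Phi Psi E.
  by rewrite !csum_nil E.
rewrite !csum_cons E //; congr (_ + _).
by apply: IH => U l r El; apply: E; rewrite /= El.
Qed.

Lemma csumD X Z (p : chain Q X Z)
    (Phi Psi : forall U, chain Q U Z -> chain Q X U -> W) :
  csum p (fun U l r => Phi U l r + Psi U l r) = csum p Phi + csum p Psi.
Proof. exact: big_split. Qed.

Lemma csum0 X Z (p : chain Q X Z) : csum p (fun U l r => 0) = 0.
Proof. by rewrite /csum big1. Qed.

Lemma csum_first X Z (p : chain Q X Z)
    (Psi : forall U, chain Q U Z -> chain Q X U -> W) :
  (forall U l r, csize l != 0%N -> Psi U l r = 0) ->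
  csum p Psi = Psi Z (cnil Z) p.
Proof.
case: p Psi => [|Y {}Z x p] Psi E; first by rewrite csum_nil.
rewrite csum_cons (eq_csum (Psi := fun U l r => 0)) ?csum0 ?addr0 // => U l r _.
exact: E.
Qed.

Lemma csum_last X Z (p : chain Q X Z)
    (Psi : forall U, chain Q U Z -> chain Q X U -> W) :
  (forall U l r, csize r != 0%N -> Psi U l r = 0) ->
  csum p Psi = Psi X p (cnil X).
Proof.
elim: p Psi => [|Y {}Z x p IH] Psi E; first by rewrite csum_nil.
by rewrite csum_cons E // add0r IH // => U l r h; apply: E.
Qed.

(** Coassociativity of the deconcatenation. *)
Lemma csumA X Z (p : chain Q X Z)
    (Psi : forall U V, chain Q V Z -> chain Q U V -> chain Q X U -> W) :
  csum p (fun V l m => csum m (fun U m r => Psi U V l m r)) =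
  csum p (fun U l r => csum l (fun V l m => Psi U V l m r)).
Proof.
elim: p Psi => [|Y {}Z x p IH] Psi; first by rewrite !csum_nil.
rewrite !csum_cons csum_nil -addrA; congr (_ + _).
rewrite (IH (fun U V l => Psi U V (ccons x l))) -csumD.
by apply: eq_csum => U l r _; rewrite csum_cons.
Qed.

End Basic.

Lemma csumZ (K : fieldType) (W : lmodType K) X Z (p : chain Q X Z) k
    (Phi : forall U, chain Q U Z -> chain Q X U -> W) :
  csum p (fun U l r => k *: Phi U l r) = k *: csum p Phi.
Proof. by rewrite /csum scaler_sumr. Qed.

Lemma lcomb_csum (K : fieldType) (W : lmodType K) T (S : seq (K * T)) X Z
    (p : chain Q X Z) (Phi : T -> forall U, chain Q U Z -> chain Q X U -> W) :
  lcomb S (fun t => csum p (Phi t)) =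
  csum p (fun U l r => lcomb S (fun t => Phi t U l r)).
Proof.
rewrite /lcomb /csum; under eq_bigr do rewrite scaler_sumr.
by rewrite exchange_big.
Qed.

Lemma csize_cat X Y Z (l : chain Q Y Z) (r : chain Q X Y) :
  csize (ccat l r) = (csize l + csize r)%N.
Proof. by elim: l r => //= U V x l IH r; rewrite IH. Qed.

Lemma cuts3_csum (W : nmodType) X Z (p : chain Q X Z)
    (Psi : forall U V, chain Q V Z -> chain Q U V -> chain Q X U -> W) :
  \sum_(c <- cuts3 p) Psi (cut3m1 c) (cut3m2 c) (cut3l c) (cut3m c) (cut3r c) =
  csum p (fun V l m => csum m (fun U m r => Psi U V l m r)).
Proof. by rewrite /cuts3 big_allpairs_dep. Qed.

End CutSums.

Lemma csumC (W : nmodType) O (Q : O -> O -> Type) O' (Q' : O' -> O' -> Type)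
    X Z (p : chain Q X Z) X' Z' (p' : chain Q' X' Z')
    (Psi : forall U, chain Q U Z -> chain Q X U ->
           forall U', chain Q' U' Z' -> chain Q' X' U' -> W) :
  csum p (fun U l r => csum p' (fun U' l' r' => Psi U l r U' l' r')) =
  csum p' (fun U' l' r' => csum p (fun U l r => Psi U l r U' l' r')).
Proof. exact: exchange_big. Qed.

Section Sdeg.
Variables (K : fieldType) (D : gquiver K).

Lemma sdeg_nil X : sdeg (cnil X : gchain D X X) = 0. Proof. by []. Qed.

Lemma sdeg_cons X Y Z (x : edge Y Z) (p : gchain D X Y) :
  sdeg (ccons x p) = (tag x - 1) + sdeg p.
Proof. rewrite /sdeg /= -addn1 PoszD; ring. Qed.

Lemma sdeg_cat X Y Z (l : gchain D Y Z) (r : gchain D X Y) :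
  sdeg (ccat l r) = sdeg l + sdeg r.
Proof.
elim: l r => [|U V x l IH] r; first by rewrite add0r.
by rewrite [ccat _ _]/= !sdeg_cons IH addrA.
Qed.

End Sdeg.

(** * The codifferential of the tensor coalgebra *)

Section Bhat.
Variables (K : fieldType) (D : ainf_ops K).

Lemma tag_bh X Z (p : gchain D X Z) : tag (bh p) = sdeg p + 2.
Proof. rewrite /sdeg /=; ring. Qed.

Section Functionals.
Variable W : lmodType K.

Lemma lcomb_bhat X Z (p : gchain D X Z) (Phi : gchain D X Z -> W) :
  lcomb (bhat p) Phi = csum p (fun V l m => csum m (fun U m r =>
    if csize m != 0%N then sgn (sdeg l) *: Phi (ccat l (ccons (bh m) r)) else 0)).
Proof.
rewrite -(cuts3_csum p (fun U V l m r => if csize m != 0%N then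
  sgn (sdeg l) *: Phi (ccat l (ccons (bh m) r)) else 0)).
by rewrite /lcomb /bhat big_map big_filter big_mkcond.
Qed.

Lemma bhat_nil X (Phi : gchain D X X -> W) : lcomb (bhat (cnil X)) Phi = 0.
Proof. by rewrite lcomb_bhat !csum_nil. Qed.

(** The piece to which b is applied either contains the first letter x or is
    contained in the rest of the chain. *)
Lemma bhat_cons X Y Z (x : edge Y Z) (p : gchain D X Y) (Phi : gchain D X Z -> W) :
  lcomb (bhat (ccons x p)) Phi =
    csum p (fun U l r => Phi (ccons (bh (ccons x l)) r)) +
    sgn (tag x - 1) *: lcomb (bhat p) (fun q => Phi (ccons x q)).
Proof.
rewrite !lcomb_bhat csum_cons csum_cons /= add0r; congr (_ + _).
  by apply: eq_csum => U l r _; rewrite sdeg_nil sgn0 scale1r.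
rewrite -csumZ; apply: eq_csum => U l m _; rewrite -csumZ.
apply: eq_csum => V {}m r _; case: ifP => _; last by rewrite scaler0.
by rewrite sdeg_cons sgnD scalerA.
Qed.

(** Functionals agreeing on the nonempty chains whose degree is raised by one,
    the only ones that occur in the codifferential. *)
Lemma eq_bhat X Z (p : gchain D X Z) (Phi Psi : gchain D X Z -> W) :
  (forall q, csize q != 0%N -> sdeg q = sdeg p + 1 -> Phi q = Psi q) ->
  lcomb (bhat p) Phi = lcomb (bhat p) Psi.
Proof.
move=> E; rewrite !lcomb_bhat; apply: eq_csum => V l q Ep.
apply: eq_csum => U m r Eq; case: ifP => // _; rewrite E //.
  by rewrite csize_cat /= addnS.
by rewrite -Ep -Eq !sdeg_cat sdeg_cons tag_bh; ring.
Qed.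

(** The codifferential is a coderivation. *)
Lemma bhat_csum X Z (p : gchain D X Z)
    (Psi : forall U, gchain D U Z -> gchain D X U -> W) :
  lcomb (bhat p) (fun q => csum q Psi) =
  csum p (fun U l r => lcomb (bhat l) (fun q => Psi U q r) +
    sgn (sdeg l) *: lcomb (bhat r) (fun q => Psi U l q)).
Proof.
elim: p Psi => [|Y {}Z x p IH] Psi.
  by rewrite bhat_nil csum_nil !bhat_nil scaler0 addr0.
rewrite csum_cons bhat_nil add0r sdeg_nil scale1r !bhat_cons.
under eq_lcomb => q do rewrite csum_cons.
rewrite lcombD scalerDr (IH (fun U l r => Psi U (ccons x l) r)).
under [in LHS]eq_csum => U l r _ do rewrite csum_cons.
rewrite csumD addrACA; congr (_ + _).
rewrite (csumA p (fun U V l m r => Psi U (ccons (bh (ccons x l)) m) r)).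
rewrite -csumZ -csumD; apply: eq_csum => U l r _.
by rewrite bhat_cons sdeg_cons scalerDr (sgnD _ _ (sdeg l)) scalerA addrA.
Qed.
End Functionals.
End Bhat.

(** * The A_oo-relations in suspended form *)

Section EdgeLinear.
Variables (K : fieldType) (V : gquiver K) (W : lmodType K).

(** Additivity makes sense only for elements of the same degree, hence
    linearity is asked on each homogeneous component. *)
Definition elin (X Y : V) (phi : edge X Y -> W) : Prop :=
  forall d k (x y : gr_hom V X Y d),
    phi (hom_elt (k *: x + y)) = k *: phi (hom_elt x) + phi (hom_elt y).

Lemma elin0 (X Y : V) (phi : edge X Y -> W) d :
  elin phi -> phi (hom_elt (0 : gr_hom V X Y d)) = 0.
Proof.
move=> h; have := h d 1 0 0; rewrite scale1r addr0 scale1r => /eqP.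
by rewrite -subr_eq0 opprD addNKr oppr_eq0 => /eqP.
Qed.

Lemma elinZ (X Y : V) (phi : edge X Y -> W) d k (x : gr_hom V X Y d) :
  elin phi -> phi (hom_elt (k *: x)) = k *: phi (hom_elt x).
Proof. by move=> h; rewrite -[k *: x]addr0 h elin0 // addr0. Qed.

Lemma elin_lcomb (X Y : V) (phi : edge X Y -> W) d T (S : seq (K * T))
    (v : T -> gr_hom V X Y d) :
  elin phi -> lcomb S (fun t => phi (hom_elt (v t))) = phi (hom_elt (lcomb S v)).
Proof.
move=> h; rewrite /lcomb; elim: S => [|[k t] S IH].
  by rewrite !big_nil elin0.
by rewrite !big_cons h IH.
Qed.

Lemma mlin_elin (X X' Z' Z : V) (l : gchain V Z' Z) (r : gchain V X X') Phi :
  mlin_at Phi -> elin (fun x : edge X' Z' => Phi (ccat l (ccons x r)) : W).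
Proof. by move=> h d k x y; apply: h. Qed.

Lemma mlin_head (X Y Z : V) (r : gchain V X Y) Phi :
  mlin_at Phi -> elin (fun x : edge Y Z => Phi (ccons x r) : W).
Proof. exact: (mlin_elin (cnil Z) r). Qed.

Lemma elin_tag0 (X Y : V) (phi : edge X Y -> W) (x : edge X Y) :
  elin phi -> tagged x = 0 -> phi x = 0.
Proof. by move=> h; case: x => d x /= ->; apply: elin0. Qed.

End EdgeLinear.

Lemma elin_at_deg (K : fieldType) (V : gquiver K) (X Y : V) e :
  elin (fun x : edge X Y => at_deg e x).
Proof. by move=> d k x y; rewrite at_degD. Qed.

Section OmegaSign.
Variables (K : fieldType) (D : gquiver K).

Lemma omega_cat (X Y Z : D) (l : gchain D Y Z) (r : gchain D X Y) :
  omega_sign (ccat l r) =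
  omega_sign l * sgn (sdeg l * (csize r)%:Z) * omega_sign r.
Proof.
elim: l r => [|U V x l IH] r /=; first by rewrite mul1r mul0r sgn0 mul1r.
rewrite IH csize_cat sdeg_cons PoszD mulrDr -/(sgn _) -/(sgn _).
rewrite !(mulrDl _ _ (csize r)%:Z) !sgnD; ring.
Qed.

Lemma omegasq (X Z : D) (p : gchain D X Z) : omega_sign p * omega_sign p = 1.
Proof.
elim: p => [|U V x p IH] /=; first by rewrite mulr1.
by rewrite mulrACA IH mulr1 -/(sgn _) sgn_sqr.
Qed.

End OmegaSign.

Section Bar.
Variables (K : fieldType) (D : ainf_ops K).

(** All terms of the formal sum u(bhat p) have the same degree e, so that they
    can be added up to one homogeneous element before phi is applied. *)
Lemma elin_bhat (W : lmodType K) (X Z : D) (p : gchain D X Z)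
    (V : gquiver K) (Y Y' : V) (u : gchain D X Z -> edge Y Y')
    (phi : edge Y Y' -> W) e :
  elin phi -> (forall q, sdeg q = sdeg p + 1 -> tag (u q) = e) ->
  lcomb (bhat p) (fun q => phi (u q)) =
  phi (hom_elt (lcomb (bhat p) (fun q => at_deg e (u q)))).
Proof.
move=> h E; rewrite -elin_lcomb //; apply: eq_bhat => q _ Eq.
by rewrite hom_elt_at_deg ?E.
Qed.

Lemma bhE (X Z : D) (p : gchain D X Z) : bh p = hom_elt (- omega_sign p *: mop D p).
Proof. by []. Qed.

Hypothesis mh_lin : multilinear (@mh K D).

Lemma bh_mlin (X Z : D) e : mlin_at (fun p : gchain D X Z => at_deg e (bh p)).
Proof.
apply: (mlin_ext (Psi := fun p : gchain D X Z =>
    (- omega_sign p) *: at_deg e (mh p))).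
  by move=> p; rewrite at_deg_scale.
apply: mlin_scale => [Y Y' l r d x y|]; last exact: mh_lin.
by rewrite (omega_sign_inv l r x y).
Qed.

(** Passing from m_n to b_n multiplies every term of the Stasheff relation by
    the same sign, that of omega^(x)n on p. *)
Lemma bh_bhat_stasheff (X Z : D) (p : gchain D X Z) e :
  lcomb (bhat p) (fun q => at_deg e (bh q)) =
  omega_sign p *: \sum_(c <- cuts3 p | csize (cut3m c) != 0%N)
    stasheff_sign c *:
      at_deg e (mh (ccat (cut3l c) (ccons (mh (cut3m c)) (cut3r c)))).
Proof.
rewrite lcomb_bhat big_mkcond /= (cuts3_csum p (fun U V l m r =>
  if csize m != 0%N then stasheff_sign (Cut3 l m r) *:
    at_deg e (mh (ccat l (ccons (mh m) r))) else 0)).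
rewrite -csumZ; apply: eq_csum => V l q Ep; rewrite -csumZ.
apply: eq_csum => U m r Eq; case: ifP => _; last by rewrite scaler0.
rewrite [bh m]bhE (elinZ _ _ (mlin_elin l r (@bh_mlin X Z e))) at_deg_scale.
rewrite !scalerA -[hom_elt _]/(mh m); congr (_ *: _).
rewrite -Ep -Eq !omega_cat /= /stasheff_sign /=.
rewrite -!/(sgn _) -[_ ^+ _]/(sgn (_)%:Z) csize_cat !PoszD !PoszM.
rewrite -addn1 PoszD.
set a := csize l; set b := csize m; set c := csize r.
have El : deg l = sdeg l + a%:Z by rewrite /sdeg subrK.
have Em : deg m = sdeg m + b%:Z by rewrite /sdeg subrK.
rewrite El Em; move: (sdeg l) (sdeg m) => L M.
transitivity (omega_sign l * omega_sign m * omega_sign r *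
  sgn (L + L * (c%:Z + 1) + (M + b%:Z + (2 - b%:Z) - 1) * c%:Z)); last first.
  transitivity (omega_sign l * omega_sign m * omega_sign r *
    sgn (L * (b%:Z + c%:Z) + M * c%:Z + (a%:Z * b%:Z + c%:Z) +
       (2 - b%:Z) * (L + a%:Z))); last by rewrite !sgnD; ring.
  congr (_ * _); apply: (@eq_sgn K (- a%:Z)); ring.
by rewrite !sgnD; ring.
Qed.

End Bar.

Section BarCat.
Variables (K : fieldType) (D : ainf_cat K).

Lemma bh_bhat (X Z : D) (p : gchain D X Z) e :
  lcomb (bhat p) (fun q => at_deg e (bh q)) = 0.
Proof.
have [->|ne] := eqVneq e (sdeg p + 3).
  rewrite (bh_bhat_stasheff (@mop_lin K D)).
  have := mop_rel p; set e0 := deg p + _; move=> E.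
  have -> : sdeg p + 3 = e0 by rewrite /sdeg /e0; ring.
  by rewrite E scaler0.
rewrite -[RHS](lcomb0 _ (bhat p)); apply: eq_bhat => q _ Eq.
apply: at_deg_neq; apply: contraNneq ne => <-.
by apply/eqP; transitivity (tag (bh q)) => //; rewrite tag_bh Eq; ring.
Qed.

Lemma bh_nil (X Z : D) (p : gchain D X Z) : csize p = 0%N -> tagged (bh p) = 0.
Proof. by case: p => // _; rewrite /= mop_nil scaler0. Qed.

Variable W : lmodType K.

Lemma bhat_bh_elin (X Z : D) (p : gchain D X Z) (phi : edge X Z -> W) :
  elin phi -> lcomb (bhat p) (fun q => phi (bh q)) = 0.
Proof.
move=> h; rewrite (elin_bhat (V := D) (e := sdeg p + 3) h) => [|q Eq].
  by rewrite bh_bhat elin0.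
by rewrite tag_bh Eq; ring.
Qed.

(** The square of a coderivation of odd degree is a coderivation, so it
    vanishes because its component b o bhat does. *)
Lemma bhat_bhat (X Z : D) (p : gchain D X Z) (Phi : gchain D X Z -> W) :
  mlin_at Phi -> lcomb (bhat p) (fun q => lcomb (bhat q) Phi) = 0.
Proof.
elim: p Phi => [|Y {}Z x p IH] Phi h; first by rewrite bhat_nil.
rewrite bhat_cons; under [X in _ + _ *: X]eq_lcomb => q do rewrite bhat_cons.
rewrite lcombD lcombZ (IH (fun q => Phi (ccons x q))) ?scaler0 ?addr0; last first.
  exact: mlin_ccons.
rewrite (bhat_csum p (fun U l r => Phi (ccons (bh (ccons x l)) r))).
under eq_csum => U l r _ do rewrite bhat_cons.
rewrite csumD.
rewrite (csumA p (fun U V l m r => Phi (ccons (bh (ccons (bh (ccons x l)) m)) r))).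
rewrite -csumZ -!csumD -[RHS](csum0 _ p); apply: eq_csum => U l r _.
rewrite -[RHS](bhat_bh_elin (ccons x l) (mlin_head r h)) bhat_cons.
rewrite scalerDr scalerA tag_bh sdeg_cons -addrA; congr (_ + _).
rewrite addrCA -[RHS]addr0; congr (_ + _); rewrite -scalerDl -sgnD.
have -> : tag x - 1 + sdeg l + 2 - 1 = (tag x - 1 + sdeg l) + 1 by ring.
by rewrite (sgnD K _ 1) sgn1 mulrN1 addNr scale0r.
Qed.

End BarCat.

(** * The coalgebra map attached to cochains *)

(** Splitting off the first piece, instead of the first letter as in [parts]. *)
Lemma big_parts_cons (O : Type) (Q : O -> O -> Type) (W : nmodType) X Y Z
    (x : Q Y Z) (p : chain Q X Y) (Phi : chain (chain Q) X Z -> W) :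
  \sum_(d <- parts (ccons x p)) Phi d =
  csum p (fun U l r => \sum_(d <- parts r) Phi (ccons (ccons x l) d)).
Proof.
have step : forall X Y Z (x : Q Y Z) (p : chain Q X Y) (Phi : chain (chain Q) X Z -> W),
    \sum_(d <- parts (ccons x p)) Phi d =
    \sum_(d <- parts p) (Phi (ccons (csing x) d) +
      \sum_(d' <- glue x d) Phi d').
  move=> {}X {}Y {}Z {}x {}p {}Phi /=; rewrite big_flatten big_map.
  by apply: eq_bigr => d _; rewrite big_cons.
rewrite step; elim: p Z x Phi => [|Y' {}Y y p IH] Z x Phi.
  by rewrite csum_nil /= !big_seq1 big_nil addr0.
rewrite big_split csum_cons; congr (_ + _).
rewrite step IH; apply: eq_csum => U l r _.
by apply: eq_bigr => d _; rewrite big_seq1.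
Qed.

Section Mix.
Variables (K : fieldType) (A B : ainf_cat K).
Local Notation N := (nunc_quiver A B).

Definition Fh (f : N) X Z (p : gchain A X Z) : edge (f X) (f Z) :=
  Fh_of (@fmor _ _ _ f) p.

(** The components, with values in SB, of the coalgebra map [mix].  The degree
    of the zero value is chosen so that [tag_letter] holds uniformly. *)
Definition letter (f g : N) (Hs : gchain N f g) X Z (p : gchain A X Z) :
    edge (f X) (g Z) :=
  let d := sdeg Hs + sdeg p + 1 in
  match Hs in chain _ _ g0 return edge (f X) (g0 Z) with
  | cnil => Fh f p
  | ccons f' g0 H Hs' =>
      match Hs' in chain _ _ f1 return edge f1 g0 -> edge (f X) (g0 Z) with
      | cnil => fun H => cochain_app H p
      | ccons _ _ _ _ => fun=> hom_elt (0 : gr_hom B (f X) (g0 Z) d)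
      end H
  end.

Lemma tag_letter (f g : N) (Hs : gchain N f g) X Z (p : gchain A X Z) :
  tag (letter Hs p) = sdeg Hs + sdeg p + 1.
Proof.
case: Hs => [|f' {}g H Hs]; first by rewrite /sdeg /=; ring.
case: Hs H => [|f1 {}f' H1 Hs] H //=.
by rewrite sdeg_cons sdeg_nil; ring.
Qed.

Lemma letter_nil (f : N) X : tagged (letter (cnil f) (cnil X : gchain A X X)) = 0.
Proof. by rewrite /= fmor_nil scaler0. Qed.

Lemma letter_long (f g : N) (Hs : gchain N f g) X Z (p : gchain A X Z) :
  (1 < csize Hs)%N -> tagged (letter Hs p) = 0.
Proof. by case: Hs => [|f' {}g H Hs] //; case: Hs H. Qed.

Section Functionals.
Variable W : lmodType K.

(** Deconcatenation of the pair (Hs, p).  The sign is the Koszul sign of Hr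
    passing l. *)
Definition pair_csum (f g : N) (Hs : gchain N f g) X Z (p : gchain A X Z)
    (Psi : forall h, gchain N h g -> gchain N f h ->
           forall U, gchain A U Z -> gchain A X U -> W) : W :=
  csum Hs (fun h Hl Hr => csum p (fun U l r =>
    sgn (sdeg Hr * sdeg l) *: Psi h Hl Hr U l r)).

(** The counit of the coalgebra of pairs, followed by Phi on the empty chain. *)
Definition eval_nil (f g : N) (Hs : gchain N f g) X Z (p : gchain A X Z) :
    (gchain B (f X) (g Z) -> W) -> W :=
  match Hs in chain _ _ g0 return (gchain B (f X) (g0 Z) -> W) -> W with
  | cnil =>
    match p in chain _ _ Z0 return (gchain B (f X) (f Z0) -> W) -> W with
    | cnil => fun Phi => Phi (cnil (f X))
    | ccons _ _ _ _ => fun=> 0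
    end
  | ccons _ _ _ _ => fun=> 0
  end.

Lemma eval_nil_pos (f g : N) (Hs : gchain N f g) X Z (p : gchain A X Z) Phi :
  (csize Hs + csize p != 0)%N -> eval_nil Hs p Phi = 0.
Proof.
case: Hs Phi => [|f' {}g H Hs] Phi //; case: p Phi => //.
Qed.

Lemma Fhat_cons (f : N) X Y Z (x : edge Y Z) (p : gchain A X Y)
    (Phi : gchain B (f X) (f Z) -> W) :
  \sum_(q <- Fhat f (ccons x p)) Phi q =
  csum p (fun U l r => \sum_(q <- Fhat f r) Phi (ccons (Fh f (ccons x l)) q)).
Proof.
rewrite big_map big_parts_cons; apply: eq_csum => U l r _.
by rewrite big_map.
Qed.

Lemma mix_cnil (f : N) X Z (p : gchain A X Z) (Phi : gchain B (f X) (f Z) -> W) :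
  lcomb (mix (cnil f) p) Phi = \sum_(q <- Fhat f p) Phi q.
Proof. by rewrite /lcomb big_map; apply: eq_bigr => q _; rewrite scale1r. Qed.

Lemma mix_ccons (f f' g : N) (H : edge f' g) (Hs : gchain N f f') X Z
    (p : gchain A X Z) (Phi : gchain B (f X) (g Z) -> W) :
  lcomb (mix (ccons H Hs) p) Phi =
  csum p (fun V l q => csum q (fun U m r =>
    sgn ((tag H - 1) * sdeg l + sdeg Hs * (sdeg l + sdeg m)) *:
    lcomb (mix (cnil g) l) (fun q => lcomb (mix Hs r) (fun s =>
      Phi (ccat q (ccons (cochain_app H m) s)))))).
Proof.
rewrite -(cuts3_csum p (fun U V l m r =>
    sgn ((tag H - 1) * sdeg l + sdeg Hs * (sdeg l + sdeg m)) *: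
    lcomb (mix (cnil g) l) (fun q => lcomb (mix Hs r) (fun s =>
      Phi (ccat q (ccons (cochain_app H m) s)))))).
rewrite /lcomb /= big_flatten big_map; apply: eq_bigr => c _.
rewrite big_allpairs_dep big_map scaler_sumr; apply: eq_bigr => q _.
by rewrite scale1r scaler_sumr; apply: eq_bigr => t _; rewrite scalerA.
Qed.

(** An empty first piece contributes nothing, as F vanishes on the empty chain.
    Hence the first piece can run over all cuts, and the case p = 1 is covered. *)
Lemma mix_cnil_recl (f : N) X Z (p : gchain A X Z) (Phi : gchain B (f X) (f Z) -> W) :
  mlin_at Phi ->
  lcomb (mix (cnil f) p) Phi = eval_nil (cnil f) p Phi + csum p (fun U l r =>
    lcomb (mix (cnil f) r) (fun s => Phi (ccons (Fh f l) s))).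
Proof.
move=> h; rewrite !mix_cnil; under eq_csum => U l r _ do rewrite mix_cnil.
case: p Phi h => [|Y {}Z x p] Phi h /=.
  rewrite csum_nil !big_seq1 (elin_tag0 (mlin_head _ h)) ?addr0 //.
  by rewrite /= fmor_nil scaler0.
rewrite add0r csum_cons Fhat_cons big1 ?add0r // => s _.
rewrite (elin_tag0 (mlin_head s h)) //.
by rewrite /= fmor_nil scaler0.
Qed.

(** A coalgebra map to a tensor coalgebra splits off its first factor, the
    letter of the first part of the pair.  The terms whose first factor is a
    component of the last functor come from the leading block of F; the term
    whose first factor is H comes from the cuts where this block is empty. *)
Lemma mix_recl (f g : N) (Hs : gchain N f g) X Z (p : gchain A X Z)
    (Phi : gchain B (f X) (g Z) -> W) :
  mlin_at Phi ->
  lcomb (mix Hs p) Phi = eval_nil Hs p Phi + pair_csum Hs p (fun h Hl Hr U l r =>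
    lcomb (mix Hr r) (fun s => Phi (ccons (letter Hl l) s))).
Proof.
case: Hs Phi => [|f' {}g H Hs] Phi h.
  rewrite mix_cnil_recl // /pair_csum csum_nil; congr (_ + _).
  by apply: eq_csum => U l r _; rewrite mul0r scale1r.
rewrite add0r /pair_csum csum_cons (csum_first Hs); last first.
  move=> k Hl Hr nz; rewrite -[RHS](csum0 _ p); apply: eq_csum => U l r _.
  rewrite (eq_lcomb _ (Psi := fun=> 0)) ?lcomb0 ?scaler0 // => s.
  apply: (elin_tag0 (mlin_head s h)); apply: letter_long.
  by rewrite /= ltnS lt0n.
have hH U V (m : gchain A U V) r : mlin_at (fun q : gchain B (g V) (g Z) =>
    lcomb (mix Hs r) (fun s => Phi (ccat q (ccons (cochain_app H m) s)))).
  apply: mlin_sum => t; apply: mlin_scale => //; exact: mlin_ccatl.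
rewrite mix_ccons.
under eq_csum => V l q _ do under eq_csum => U m r _ do
  rewrite mix_cnil_recl // scalerDr.
under eq_csum => V l q _ do rewrite csumD.
rewrite csumD addrC; congr (_ + _); last first.
  rewrite csum_first => [|V l q nz].
    by apply: eq_csum => U l r _; rewrite mulr0 !add0r.
  rewrite -[RHS](csum0 _ q); apply: eq_csum => U m r _.
  by rewrite eval_nil_pos // scaler0.
pose Psi U T V (l1 : gchain A V Z) (l2 : gchain A T V) (m : gchain A U T)
    (r : gchain A X U) :=
  sgn (sdeg (ccons H Hs) * sdeg l1) *:
  (sgn ((tag H - 1) * sdeg l2 + sdeg Hs * (sdeg l2 + sdeg m)) *:
  lcomb (mix (cnil g) l2) (fun q => lcomb (mix Hs r) (fun s =>
      Phi (ccons (Fh g l1) (ccat q (ccons (cochain_app H m) s)))))).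
transitivity (csum p (fun T l q => csum l (fun V l1 l2 =>
    csum q (fun U m r => Psi U T V l1 l2 m r)))); last first.
  rewrite -csumA; apply: eq_csum => V l1 q _.
  rewrite mix_ccons -csumZ; apply: eq_csum => T l2 R _.
  by rewrite -csumZ.
apply: eq_csum => T l q _; rewrite csumC; apply: eq_csum => U m r _.
rewrite -csumZ; apply: eq_csum => V l1 l2 <-; rewrite /Psi scalerA -sgnD.
congr (_ *: _); congr sgn; rewrite sdeg_cons sdeg_cat; ring.
Qed.

End Functionals.
End Mix.

(** * Comultiplicativity *)

Section PairedCuts.
Variables (K : fieldType) (A B : ainf_cat K).
Local Notation N := (nunc_quiver A B).

Section Functionals.
Variable W : lmodType K.

Definition pairfun (f g : N) (X Z : A) :=
  forall h, gchain N h g -> gchain N f h ->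
  forall U, gchain A U Z -> gchain A X U -> W.

Lemma eq_pair_csum (f g : N) (Hs : gchain N f g) X Z (p : gchain A X Z)
    (Phi Psi : pairfun f g X Z) :
  (forall h Hl Hr U l r, ccat Hl Hr = Hs -> ccat l r = p ->
     Phi h Hl Hr U l r = Psi h Hl Hr U l r) ->
  pair_csum Hs p Phi = pair_csum Hs p Psi.
Proof.
move=> E; apply: eq_csum => h Hl Hr EH; apply: eq_csum => U l r Ep.
by rewrite E.
Qed.

Lemma pair_csumD (f g : N) (Hs : gchain N f g) X Z (p : gchain A X Z)
    (Phi Psi : pairfun f g X Z) :
  pair_csum Hs p (fun h Hl Hr U l r => Phi h Hl Hr U l r + Psi h Hl Hr U l r) =
  pair_csum Hs p Phi + pair_csum Hs p Psi.
Proof.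
rewrite /pair_csum -csumD; apply: eq_csum => h Hl Hr _.
by rewrite -csumD; apply: eq_csum => U l r _; rewrite scalerDr.
Qed.

Lemma pair_csum0 (f g : N) (Hs : gchain N f g) X Z (p : gchain A X Z) :
  pair_csum Hs p (fun h Hl Hr U l r => 0 : W) = 0.
Proof.
rewrite /pair_csum -[RHS](csum0 _ Hs); apply: eq_csum => h Hl Hr _.
by rewrite -[RHS](csum0 _ p); apply: eq_csum => U l r _; rewrite scaler0.
Qed.

Lemma pair_csum_first (f g : N) (Hs : gchain N f g) X Z (p : gchain A X Z)
    (Psi : pairfun f g X Z) :
  (forall h Hl Hr U l r, (csize Hl + csize l != 0)%N ->
     Psi h Hl Hr U l r = 0) ->
  pair_csum Hs p Psi = Psi g (cnil g) Hs Z (cnil Z) p.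
Proof.
move=> E; rewrite /pair_csum csum_first => [|h Hl Hr nz].
  rewrite csum_first => [|U l r nz]; first by rewrite sdeg_nil mulr0 scale1r.
  by rewrite E // scaler0.
rewrite -[RHS](csum0 _ p); apply: eq_csum => U l r _.
by rewrite E ?scaler0 // addn_eq0 negb_and nz.
Qed.

Lemma pair_csumA (f g : N) (Hs : gchain N f g) X Z (p : gchain A X Z)
    (Psi : forall h k, gchain N k g -> gchain N h k -> gchain N f h ->
      forall U V, gchain A V Z -> gchain A U V -> gchain A X U -> W) :
  pair_csum Hs p (fun k H1 H23 V p1 p23 => pair_csum H23 p23 (fun h H2 H3 U p2 p3 =>
    Psi h k H1 H2 H3 U V p1 p2 p3)) =
  pair_csum Hs p (fun h H12 H3 U p12 p3 => pair_csum H12 p12 (fun k H1 H2 V p1 p2 =>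
    Psi h k H1 H2 H3 U V p1 p2 p3)).
Proof.
pose s h k (H1 : gchain N k g) (H2 : gchain N h k) (H3 : gchain N f h)
  U V (p1 : gchain A V Z) (p2 : gchain A U V) (p3 : gchain A X U) :=
  sgn ((sdeg H2 + sdeg H3) * sdeg p1 + sdeg H3 * sdeg p2) *:
  Psi h k H1 H2 H3 U V p1 p2 p3.
transitivity (csum Hs (fun k H1 H23 => csum H23 (fun h H2 H3 =>
  csum p (fun V p1 p23 => csum p23 (fun U p2 p3 =>
    s h k H1 H2 H3 U V p1 p2 p3))))).
  apply: eq_csum => k H1 H23 _; rewrite csumC; apply: eq_csum => V p1 p23 _.
  rewrite /pair_csum -csumZ; apply: eq_csum => h H2 H3 <-.
  rewrite -csumZ; apply: eq_csum => U p2 p3 _.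
  by rewrite /s scalerA -sgnD sdeg_cat.
rewrite csumA.
apply: eq_csum => h H12 H3 _.
under eq_csum => k H1 H2 _ do rewrite csumA.
rewrite csumC; apply: eq_csum => U p12 p3 _.
rewrite /pair_csum -csumZ; apply: eq_csum => k H1 H2 _.
rewrite -csumZ; apply: eq_csum => V p1 p2 <-.
rewrite /s scalerA -sgnD sdeg_cat; congr (_ *: _); congr sgn; ring.
Qed.

Lemma eq_eval_nil (f g : N) (Hs : gchain N f g) X Z (p : gchain A X Z)
    (Phi Psi : gchain B (f X) (g Z) -> W) :
  (forall q, csize q = 0%N -> Phi q = Psi q) -> eval_nil Hs p Phi = eval_nil Hs p Psi.
Proof.
by case: Hs Phi Psi => [|f' {}g H Hs] Phi Psi //; case: p Phi Psi => //= Phi Psi ->.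
Qed.

Lemma eval_nil0 (f g : N) (Hs : gchain N f g) X Z (p : gchain A X Z) :
  eval_nil Hs p (fun=> 0) = 0 :> W.
Proof. by case: Hs => // ; case: p. Qed.

Lemma letter_empty (f g : N) (Hs : gchain N f g) X Z (p : gchain A X Z) :
  (csize Hs + csize p = 0)%N -> tagged (letter Hs p) = 0.
Proof. by case: Hs => // ; case: p => // *; apply: letter_nil. Qed.

(** Induction on the size of the pair through [mix_recl].  The induction
    hypothesis applies to the second part of the pair whenever the first part
    is nonempty; when it is empty, its letter vanishes. *)
Lemma mix_csum (f g : N) (Hs : gchain N f g) X Z (p : gchain A X Z)
    (Psi : forall T, gchain B T (g Z) -> gchain B (f X) T -> W) :
  (forall T r, mlin_at (fun l => Psi T l r)) -> (forall T l, mlin_at (Psi T l)) ->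
  lcomb (mix Hs p) (fun s => csum s Psi) =
  pair_csum Hs p (fun h Hl Hr U l r => lcomb (mix Hl l) (fun s1 =>
    lcomb (mix Hr r) (fun s2 => Psi _ s1 s2))).
Proof.
have [n] := ubnP (csize Hs + csize p)%N.
elim: n => // n IH in f g Hs X Z p Psi * => szP hl hr.
rewrite mix_recl; last exact: mlin_cuts.
under eq_pair_csum => h Hl Hr U l r _ _ do
  (under eq_lcomb => s do rewrite csum_cons; rewrite lcombD).
rewrite pair_csumD addrA.
(* the cuts at the very left: both sides are [mix_recl] for Psi (cnil _) *)
rewrite (eq_eval_nil Hs p (Psi := Psi (g Z) (cnil _))); last first.
  move=> q; move: Psi hl hr; move: (f X) (g Z) q => T T' [|//] Psi _ _ _.
  by rewrite csum_nil.
rewrite -mix_recl //.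
under [RHS]eq_pair_csum => h Hl Hr U l r _ _ do
  (rewrite mix_recl; last by apply: mlin_sum => t; apply: mlin_scale).
rewrite pair_csumD; congr (_ + _).
  rewrite pair_csum_first //= => h Hl Hr U l r nz.
  exact: eval_nil_pos.
rewrite -(pair_csumA Hs p (fun h k H1 H2 H3 U V p1 p2 p3 => lcomb (mix H2 p2) (fun s1 =>
  lcomb (mix H3 p3) (fun s2 => Psi _ (ccons (letter H1 p1) s1) s2)))).
apply: eq_pair_csum => k H1 HR V p1 pR EH Ep.
have [z|nz] := eqVneq (csize H1 + csize p1)%N 0%N.
  transitivity (0 : W).
    rewrite -[RHS](lcomb0 _ (mix HR pR)); apply: eq_lcomb => s.
    rewrite -[RHS](csum0 _ s); apply: eq_csum => T s1 s2 _.
    by apply: (elin_tag0 (mlin_head s1 (hl T s2))); apply: letter_empty.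
  rewrite -[LHS](pair_csum0 HR pR); apply: eq_pair_csum => h H2 H3 U p2 p3 _ _.
  rewrite -[LHS](lcomb0 _ (mix H2 p2)); apply: eq_lcomb => s1.
  rewrite -[LHS](lcomb0 _ (mix H3 p3)); apply: eq_lcomb => s2.
  by rewrite (elin_tag0 (mlin_head s1 (hl _ s2))) // letter_empty.
rewrite (IH _ _ HR _ _ pR (fun T s1 s2 => Psi T (ccons (letter H1 p1) s1) s2)) //.
  by move: nz szP; rewrite -EH -Ep !csize_cat; lia.
by move=> T r; exact: (mlin_ccons (Phi := fun l => Psi T l r) _ (hl T r)).
Qed.

End Functionals.
End PairedCuts.

(** * The codifferential on pairs *)

Section PairCodifferential.
Variables (K : fieldType) (A B : ainf_cat K).
Local Notation N := (nunc_quiver A B).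
Local Notation NuncAB := (Nunc A B).

Lemma cochainZE (f g : N) d k (H : cochain f g d) X Z (p : gchain A X Z) :
  (k *: H) X Z p = k *: H X Z p.
Proof. by rewrite -[LHS]/(k *: H X Z p + 0) addr0. Qed.

Lemma cochainDE (f g : N) d (H H' : cochain f g d) X Z (p : gchain A X Z) :
  (H + H') X Z p = H X Z p + H' X Z p.
Proof. by rewrite -[LHS]/(1 *: H X Z p + H' X Z p) scale1r. Qed.

Lemma cochain_app_bh (f g : N) (Hs : gchain NuncAB f g) X Z (p : gchain A X Z) :
  csize Hs != 0%N ->
  cochain_app (bh Hs) p = hom_elt (nunc_b Hs p (sdeg p + (sdeg Hs + 2))).
Proof.
move=> nz; rewrite -tag_bh /cochain_app bhE /=; congr (hom_elt _).
rewrite addr0 /nunc_val (negPf nz) scalerA mulrNN omegasq.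
exact: scale1r.
Qed.

Lemma nunc_bE (f g : N) (Hs : gchain N f g) X Z (p : gchain A X Z) e :
  nunc_b Hs p e = lcomb (mix Hs p) (fun s => at_deg e (bh s)) + nunc_b1_extra Hs p e.
Proof. by []. Qed.

Lemma nunc_b1_extra_csing (f g : N) (H : edge f g) X Z (p : gchain A X Z) e :
  nunc_b1_extra (csing H) p e =
  - sgn (tag H - 1) *: lcomb (bhat p) (fun q => at_deg e (cochain_app H q)).
Proof. by []. Qed.

Lemma nunc_b1_extra_long (f g : N) (Hs : gchain N f g) X Z (p : gchain A X Z) e :
  (csize Hs != 1)%N -> nunc_b1_extra Hs p e = 0.
Proof. by case: Hs => // f' {}g H Hs; case: Hs H. Qed.

Section Functionals.
Variable W : lmodType K.

Lemma eq_Fhat (f : N) X Z (p : gchain A X Z) (Phi Psi : gchain B (f X) (f Z) -> W) :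
  (forall s, sdeg s = sdeg p -> Phi s = Psi s) ->
  \sum_(q <- Fhat f p) Phi q = \sum_(q <- Fhat f p) Psi q.
Proof.
have [n] := ubnP (csize p).
elim: n => // n IH in X Z p Phi Psi *.
case: p Phi Psi => [|Y {}Z x p] Phi Psi szp E.
  by rewrite !big_seq1 E.
rewrite !Fhat_cons; apply: eq_csum => U l r Ep; apply: IH => [|s Es].
  by move: szp; rewrite /= -Ep csize_cat; lia.
apply: E; rewrite !sdeg_cons Es -Ep sdeg_cat /Fh /Fh_of /sdeg /=.
by rewrite -addn1 PoszD; ring.
Qed.

Lemma eq_mix (f g : N) (Hs : gchain N f g) X Z (p : gchain A X Z)
    (Phi Psi : gchain B (f X) (g Z) -> W) :
  (forall s, sdeg s = sdeg Hs + sdeg p -> Phi s = Psi s) ->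
  lcomb (mix Hs p) Phi = lcomb (mix Hs p) Psi.
Proof.
elim: Hs X Z p Phi Psi => [|f' {}g H Hs IH] X Z p Phi Psi E.
  by rewrite !mix_cnil; apply: eq_Fhat => s Es; rewrite E // Es add0r.
rewrite !mix_ccons; apply: eq_csum => V l q Ep; apply: eq_csum => U m r Eq.
congr (_ *: _); rewrite !mix_cnil; apply: eq_Fhat => s1 E1.
apply: IH => s2 E2; apply: E; rewrite sdeg_cat sdeg_cons E1 E2 -Ep -Eq /=.
by rewrite !sdeg_cat sdeg_cons; ring.
Qed.

(** The codifferential of T^c(S Nunc) (x) T^c(SA). *)
Definition pair_bhat (f g : N) (Hs : gchain N f g) X Z (p : gchain A X Z)
    (Theta : gchain N f g -> gchain A X Z -> W) : W :=
  lcomb (bhat (D := NuncAB) Hs) (fun Hs' => Theta Hs' p) +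
  sgn (sdeg Hs) *: lcomb (bhat p) (fun p' => Theta Hs p').

(** The tensor product of two coderivations is a coderivation. *)
Lemma pair_bhat_csum (f g : N) (Hs : gchain N f g) X Z (p : gchain A X Z)
    (Psi : pairfun W f g X Z) :
  pair_bhat Hs p (fun Hs' p' => pair_csum Hs' p' Psi) =
  pair_csum Hs p (fun h Hl Hr U l r =>
    pair_bhat Hl l (fun Hl' l' => Psi h Hl' Hr U l' r) +
    sgn (sdeg Hl + sdeg l) *: pair_bhat Hr r (fun Hr' r' => Psi h Hl Hr' U l r')).
Proof.
rewrite /pair_bhat {1}/pair_csum bhat_csum -lcombZ /pair_csum.
under [X in _ + X]eq_lcomb => p' do rewrite -csumZ.
rewrite lcomb_csum -csumD; apply: eq_csum => h Hl Hr EH.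
rewrite !lcomb_csum -csumZ.
under [X in _ + X]eq_lcomb => p' do rewrite -csumZ.
rewrite bhat_csum -!csumD; apply: eq_csum => U l r Ep.
rewrite !lcombZ !scalerDr !scalerA.
rewrite (@eq_bhat _ NuncAB _ _ _ Hr _ (fun q =>
  sgn (sdeg Hr * sdeg l + sdeg l) *: Psi h Hl q U l r)); last first.
  by move=> q _ Eq; rewrite Eq mulrDl mul1r.
rewrite lcombZ scalerA.
rewrite (@eq_bhat _ _ _ _ _ l _ (fun q =>
  sgn (sdeg Hr * sdeg l + sdeg Hr) *: Psi h Hl Hr U q r)); last first.
  by move=> q _ Eq; rewrite Eq mulrDr mulr1.
rewrite lcombZ !scalerA [LHS]addrACA -EH sdeg_cat.
congr (_ + _ *: _ + (_ *: _ + _ *: _)); rewrite -!sgnD.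
- apply: (@eq_sgn K (sdeg Hr)); ring.
- congr sgn; ring.
congr sgn; ring.
Qed.

End Functionals.
End PairCodifferential.

(** * Compatibility with the codifferentials *)

Section CoalgebraMap.
Variables (K : fieldType) (A B : ainf_cat K).
Local Notation N := (nunc_quiver A B).
Local Notation NuncAB := (Nunc A B).

Section Functionals.
Variable W : lmodType K.

Lemma elin_mix (f g : N) (Hs : gchain N f g) X Z (p : gchain A X Z)
    (phi : edge (f X) (g Z) -> W) e :
  elin phi -> e = sdeg Hs + sdeg p + 2 ->
  lcomb (mix Hs p) (fun s => phi (bh s)) =
  phi (hom_elt (lcomb (mix Hs p) (fun s => at_deg e (bh s)))).
Proof.
move=> h E; rewrite -elin_lcomb //; apply: eq_mix => s Es.
by rewrite hom_elt_at_deg // tag_bh Es E.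
Qed.

(** Among the terms of the codifferential of Hs, the letter only sees the one
    where b is applied to all of Hs. *)
Lemma bhat_letter (f g : N) (Hs : gchain N f g) X Z (p : gchain A X Z)
    (phi : edge (f X) (g Z) -> W) :
  elin phi -> csize Hs != 0%N ->
  lcomb (bhat (D := NuncAB) Hs) (fun Hs' => phi (letter Hs' p)) =
  phi (hom_elt (nunc_b Hs p (sdeg p + (sdeg Hs + 2)))).
Proof.
case: Hs phi => [|f' {}g H Hs] phi h // nz.
rewrite bhat_cons csum_last => [|k Hl Hr nzr]; last first.
  by apply: elin_tag0 => //; apply: letter_long; rewrite /= ltnS lt0n.
rewrite -cochain_app_bh // [X in _ + _ *: X](_ : _ = 0) ?scaler0 ?addr0 //.
rewrite -[RHS](lcomb0 _ (bhat (D := NuncAB) Hs)); apply: eq_bhat => Hs' nz' _.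
by apply: elin_tag0 => //; apply: letter_long; rewrite /= ltnS lt0n.
Qed.

(** The equation of [mix_bhat] after projection to SB.  For Hs empty it is the
    relation of an A_oo-functor.  For Hs = H the extra term in the definition
    of b_1 cancels the part of the codifferential acting on p, and for longer
    Hs it is the definition of b_i. *)
Lemma mix_cogenerator (f g : N) (Hs : gchain N f g) X Z (p : gchain A X Z)
    (phi : edge (f X) (g Z) -> W) :
  elin phi ->
  lcomb (mix Hs p) (fun s => phi (bh s)) =
  pair_bhat Hs p (fun Hs' p' => phi (letter Hs' p')).
Proof.
move=> h; rewrite /pair_bhat.
have [nz|nz] := eqVneq (csize Hs) 0%N.
  case: Hs nz phi h => // _ phi h; rewrite bhat_nil add0r scale1r.
  rewrite (elin_mix (e := sdeg p + 2)) ?add0r //.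
  rewrite (elin_bhat (e := sdeg p + 2) h) => [|q Eq]; last first.
    by rewrite tag_letter Eq; ring.
  by congr (phi (hom_elt _)); rewrite mix_cnil; apply: fmor_rel.
rewrite bhat_letter // nunc_bE; set e := sdeg p + _.
rewrite (elin_mix (e := e)) //; last by rewrite /e; ring.
rewrite -[X in hom_elt (X + _)]scale1r h scale1r -addrA -[LHS]addr0.
congr (_ + _).
have [nz1|nz1] := eqVneq (csize Hs) 1%N; last first.
  rewrite nunc_b1_extra_long // elin0 // add0r -[LHS](scaler0 _ (sgn (sdeg Hs))).
  congr (_ *: _); rewrite -[LHS](lcomb0 _ (bhat p)); apply: eq_lcomb => q.
  by rewrite elin_tag0 // letter_long //; case: (csize Hs) nz nz1 => [|[]].
case: Hs nz nz1 phi h @e => // f' {}g H Hs; case: Hs H => [|f1 {}f' H1 Hs] H _ // _ phi h e.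
rewrite nunc_b1_extra_csing elinZ // (elin_bhat (u := fun q => letter (csing H) q) (e := e) h) => [|q Eq].
  by rewrite sdeg_cons sdeg_nil addr0 scaleNr addNr.
by rewrite tag_letter Eq /e; ring.
Qed.

Lemma pair_bhatD (f g : N) (Hs : gchain N f g) X Z (p : gchain A X Z) T T' :
  pair_bhat Hs p (fun Hs' p' => T Hs' p' + T' Hs' p') = pair_bhat Hs p T + pair_bhat Hs p T' :> W.
Proof. by rewrite /pair_bhat !lcombD scalerDr addrACA. Qed.

Lemma pair_bhat_eval_nil (f g : N) (Hs : gchain N f g) X Z (p : gchain A X Z) Phi :
  pair_bhat Hs p (fun Hs' p' => eval_nil Hs' p' Phi) = 0 :> W.
Proof.
rewrite /pair_bhat (@eq_bhat _ NuncAB _ _ _ Hs _ (fun=> 0)) => [|q nz _]; last first.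
  by rewrite eval_nil_pos // addn_eq0 negb_and nz.
rewrite (eq_bhat (p := p) (Psi := fun=> 0)) => [|q nz _]; last first.
  by rewrite eval_nil_pos // addn_eq0 negb_and nz orbT.
by rewrite !lcomb0 scaler0 addr0.
Qed.

Lemma eq_pair_bhat (f g : N) (Hs : gchain N f g) X Z (p : gchain A X Z) T T' :
  (forall Hs p, T Hs p = T' Hs p) -> pair_bhat Hs p T = pair_bhat Hs p T' :> W.
Proof. by move=> E; congr (_ + _ *: _); apply: eq_lcomb => q; apply: E. Qed.

(** Both sides are coderivations along the coalgebra map [mix], and they agree
    on cogenerators.  Explicitly: split off the first letter on both sides; the
    terms where b avoids it agree by induction, the others by
    [mix_cogenerator]. *)
Lemma mix_bhat (f g : N) (Hs : gchain N f g) X Z (p : gchain A X Z)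
    (Phi : gchain B (f X) (g Z) -> W) :
  mlin_at Phi ->
  lcomb (mix Hs p) (fun s => lcomb (bhat s) Phi) =
  pair_bhat Hs p (fun Hs' p' => lcomb (mix Hs' p') Phi).
Proof.
have [n] := ubnP (csize Hs + csize p)%N.
elim: n => // n IH in f g Hs X Z p Phi * => szP h.
rewrite mix_recl; last exact: bhat_lin.
rewrite [eval_nil _ _ _](_ : _ = 0) ?add0r; last first.
  case: Hs {szP} Phi h => //; case: p => // Phi _; exact: bhat_nil.
rewrite (eq_pair_bhat _ _ (T' := fun Hs' p' => eval_nil Hs' p' Phi + pair_csum Hs' p'
  (fun k Hl Hr U l r => lcomb (mix Hr r) (fun s => Phi (ccons (letter Hl l) s)))));
  last by move=> *; apply: mix_recl.
rewrite pair_bhatD pair_bhat_eval_nil add0r pair_bhat_csum pair_csumD.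
under eq_pair_csum => k Hl Hr U l r _ _ do
  (under eq_lcomb => s do rewrite bhat_cons; rewrite lcombD lcombZ).
rewrite pair_csumD; congr (_ + _); last first.
  apply: eq_pair_csum => k Hl Hr U l r EH Ep.
  have -> : tag (letter Hl l) - 1 = sdeg Hl + sdeg l by rewrite tag_letter addrK.
  congr (_ *: _).
  have [z|nz] := eqVneq (csize Hl + csize l)%N 0%N.
    transitivity (0 : W).
      rewrite -[RHS](lcomb0 _ (mix Hr r)); apply: eq_lcomb => s.
      rewrite -[RHS](lcomb0 _ (bhat s)); apply: eq_lcomb => q.
      by rewrite (elin_tag0 (mlin_head q h)) // letter_empty.
    rewrite (eq_pair_bhat _ _ (T' := fun _ _ => 0)) => [|Hr' r'].
      by rewrite /pair_bhat !lcomb0 scaler0 addr0.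
    rewrite -[RHS](lcomb0 _ (mix Hr' r')); apply: eq_lcomb => s.
    by rewrite (elin_tag0 (mlin_head s h)) // letter_empty.
  rewrite (IH _ _ Hr _ _ r (fun s => Phi (ccons (letter Hl l) s))) //.
    by move: nz szP; rewrite -EH -Ep !csize_cat; lia.
  exact: mlin_ccons.
have hb U (s2 : gchain B (f X) U) :
    mlin_at (fun s : gchain B U (g Z) => Phi (ccons (bh s) s2)).
  apply: (mlin_plug (cnil (g Z)) s2 (U := fun s => bh s)) h.
    exact: tag_bh_inv.
  exact: bh_lin.
transitivity (pair_csum Hs p (fun k H1 H23 V p1 p23 => pair_csum H23 p23
  (fun h1 H2 H3 U p2 p3 => lcomb (mix H2 p2) (fun s1 => lcomb (mix H3 p3) (fun s2 =>
     Phi (ccons (bh (ccons (letter H1 p1) s1)) s2)))))).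
  apply: eq_pair_csum => k Hl Hr U l r _ _.
  rewrite (mix_csum _ _ (Psi := fun T s1 s2 => Phi (ccons (bh (ccons (letter Hl l) s1)) s2))) //.
    move=> T s2; exact: (mlin_ccons (Phi := fun s => Phi (ccons (bh s) s2)) _ (hb T s2)).
  by move=> T s1; exact: mlin_ccons.
rewrite pair_csumA; apply: eq_pair_csum => k Hl Hr U l r _ _.
rewrite -(mix_cogenerator Hl l (phi := fun x =>
  lcomb (mix Hr r) (fun s2 => Phi (ccons x s2)))); last first.
  move=> d a x y; rewrite -lcombZ -lcombD; apply: eq_lcomb => s.
  exact: (mlin_head s h).
rewrite [RHS]mix_recl; last first.
  by apply: mlin_sum => t; apply: mlin_scale.
rewrite (eq_eval_nil _ _ (Psi := fun=> 0)) => [|s1 z].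
  by rewrite eval_nil0 add0r.
rewrite -[RHS](lcomb0 _ (mix Hr r)); apply: eq_lcomb => s.
by rewrite (elin_tag0 (mlin_head s h)) // bh_nil.
Qed.

End Functionals.
End CoalgebraMap.

(** * The A_oo-category of A_oo-functors *)

Section NuncCat.
Variables (K : fieldType) (A B : ainf_cat K).
Local Notation N := (nunc_quiver A B).
Local Notation NuncAB := (Nunc A B).

Lemma scalerC (W : lmodType K) (a b : K) (v : W) : a *: (b *: v) = b *: (a *: v).
Proof. by rewrite !scalerA mulrC. Qed.

Lemma mix_lin_cochains (W : lmodType K) (f g : N) X Z (p : gchain A X Z)
    (Phi : gchain B (f X) (g Z) -> W) :
  mlin_at Phi -> mlin_at (fun Hs : gchain N f g => lcomb (mix Hs p) Phi).
Proof.
move=> h f1 f2 l r d k x y.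
elim: l X Z p Phi h => [|f3 f4 z l IH] X Z p Phi h.
  rewrite !mix_ccons -csumZ -csumD; apply: eq_csum => V l q _.
  rewrite -csumZ -csumD; apply: eq_csum => U m r' _.
  rewrite ![tag (hom_elt _)]/= (scalerC k) -scalerDr; congr (_ *: _).
  rewrite -lcombZ -lcombD; apply: eq_lcomb => s1; rewrite -lcombZ -lcombD; apply: eq_lcomb => s2.
  have -> : cochain_app (hom_elt (k *: x + y)) m = hom_elt (k *: x U V m + y U V m).
    by rewrite /cochain_app /= scale1r addr0.
  by rewrite h.
rewrite !mix_ccons -csumZ -csumD; apply: eq_csum => V l' q _.
rewrite -csumZ -csumD; apply: eq_csum => U m r' _.
rewrite (sdeg_inv l r (k *: x + y) y) (sdeg_inv l r x y).
rewrite (scalerC k) -scalerDr; congr (_ *: _).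
rewrite -lcombZ -lcombD; apply: eq_lcomb => s1.
apply: (IH _ _ _ (fun s => Phi (ccat s1 (ccons (cochain_app z m) s)))).
exact: (mlin_ccons (Phi := fun s => Phi (ccat s1 s)) _ (mlin_ccatr _ h)).
Qed.

Lemma cochain_lcomb (f g : N) d T (S : seq (K * T)) (v : T -> cochain f g d) X Z
    (p : gchain A X Z) :
  (lcomb S v : cochain f g d) X Z p = lcomb S (fun t => v t X Z p).
Proof.
rewrite /lcomb; elim: S => [|t S IH]; first by rewrite !big_nil.
by rewrite !big_cons cochainDE cochainZE IH.
Qed.

Lemma cochain_at_deg (f g : N) (Hs : gchain NuncAB f g) e X Z (p : gchain A X Z) :
  cochain_val (at_deg e (mh Hs)) p =
  if tag (mh Hs) == e then nunc_val Hs p (sdeg p + e) else 0.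
Proof.
have [<-|ne] := eqVneq (tag (mh Hs)) e; last by rewrite at_deg_neq.
by rewrite at_deg_id.
Qed.

(** The two signs of omega^(x)i in b_i = - s m_i omega^(x)i and in the
    definition of m_i cancel. *)
Lemma cochain_bh (f g : N) (Hs : gchain NuncAB f g) e X Z (p : gchain A X Z) :
  csize Hs != 0%N -> e = sdeg Hs + 2 ->
  cochain_val (at_deg e (bh Hs)) p = nunc_b Hs p (sdeg p + e).
Proof.
move=> nz E; rewrite at_deg_scale cochainZE cochain_at_deg.
rewrite [tag _]tag_bh E eqxx /nunc_val (negPf nz) scalerA mulrNN omegasq.
by rewrite scale1r.
Qed.

Lemma nunc_b1_extra_lin (f g : N) X Z (p : gchain A X Z) e :
  mlin_at (fun Hs : gchain N f g => nunc_b1_extra Hs p e).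
Proof.
move=> f1 f2 l r d k x y.
have [|long] := eqVneq (csize l + csize r)%N 0%N; last first.
  by rewrite !nunc_b1_extra_long ?scaler0 ?addr0 // csize_cat /= addnS eqSS.
case: l => // ; case: r => // in x y * => _.
rewrite !(nunc_b1_extra_csing (hom_elt _)) /= scalerC -scalerDr; congr (_ *: _).
rewrite -lcombZ -lcombD; apply: eq_lcomb => q.
by rewrite -at_degD; congr (at_deg e _); rewrite /cochain_app /= scale1r addr0.
Qed.

Fact nunc_mh_lin : multilinear (@mh K NuncAB).
Proof.
move=> f g e.
have inv : shape_inv (fun Hs : gchain N f g => tag (mh (D := NuncAB) Hs)).
  by move=> Y Y' l r d x y; rewrite /= (deg_inv l r x y) (csize_inv l r x y).
suff lin X Z (p : gchain A X Z) :
    mlin_at (fun Hs : gchain N f g => cochain_val (at_deg e (mh (D := NuncAB) Hs)) p).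
  move=> Y Y' l r d k x y; apply: cochain_ext => X Z p.
  by rewrite cochainDE cochainZE; apply: lin.
apply: (mlin_ext (Psi := fun Hs : gchain N f g =>
    if (tag (mh (D := NuncAB) Hs) == e) && (csize Hs != 0%N) then
      - omega_sign Hs *: nunc_b Hs p (sdeg p + e) else 0)).
  move=> Hs; rewrite cochain_at_deg /nunc_val.
  by case: (_ == e) => //=; case: (_ == 0%N).
apply: mlin_if => [Y Y' l r d x y|].
  by rewrite (inv _ _ l r d x y) (csize_inv l r x y).
apply: mlin_scale => [Y Y' l r d x y|]; first by rewrite (omega_sign_inv l r x y).
exact: (mlin_add (mix_lin_cochains p (@bh_lin K B _ _ _)) (nunc_b1_extra_lin p _)).
Qed.

(** The additional term of b_1 occurs for the single term of the
    codifferential of Hs where b is applied to all of Hs. *)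
Lemma bhat_nunc_b1_extra (f g : N) (Hs : gchain NuncAB f g) X Z (p : gchain A X Z) E :
  csize Hs != 0%N -> E = sdeg p + sdeg Hs + 3 ->
  lcomb (bhat Hs) (fun q => nunc_b1_extra q p E) =
  sgn (sdeg Hs) *: lcomb (bhat p) (fun q => nunc_b Hs q E).
Proof.
case: Hs => // f' {}g H Hs nz EE; rewrite bhat_cons.
rewrite [X in _ + _ *: X](_ : _ = 0) ?scaler0 ?addr0; last first.
  rewrite -[RHS](lcomb0 _ (bhat (D := NuncAB) Hs)); apply: eq_bhat => q nz' _.
  by rewrite nunc_b1_extra_long // eqSS.
rewrite csum_last => [|k Hl Hr nz']; last by rewrite nunc_b1_extra_long.
rewrite nunc_b1_extra_csing [tag _ - 1](_ : _ = sdeg (ccons H Hs) + 1); last first.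
  by rewrite [tag _](tag_bh (D := NuncAB)); ring.
rewrite sgnD sgn1 mulrN1 opprK; congr (_ *: _); apply: eq_bhat => q _ Eq.
rewrite cochain_app_bh // (at_deg_hom_elt E _ (nunc_b (ccons H Hs) q)) ifT //.
by rewrite EE Eq; apply/eqP; ring.
Qed.

Fact nunc_mop_nil (f : N) : mop NuncAB (cnil f) = 0.
Proof. by apply: cochain_ext. Qed.

(** By [mix_bhat], applying b to the codifferential of the mixed chains gives,
    on the one side, zero by the relations of B and, on the other, the sum
    to be computed up to the additional terms of b_1.  Those vanish as the
    codifferential of T^c(SA) has square zero. *)
Fact nunc_bar (f g : N) (Hs : gchain NuncAB f g) e :
  e = sdeg Hs + 3 -> lcomb (bhat Hs) (fun q => at_deg e (bh q)) = 0.
Proof.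
move=> Ee; have [nz|nz] := eqVneq (csize Hs) 0%N.
  by case: Hs nz Ee => // _ _; rewrite bhat_nil.
apply: cochain_ext => X Z p; rewrite cochain_lcomb.
set E := sdeg p + e.
have lin : mlin_at (fun s : gchain B (f X) (g Z) => at_deg E (bh s)).
  exact: bh_lin.
rewrite (@eq_bhat _ NuncAB _ _ _ Hs _ (fun q => lcomb (mix q p) (fun s => at_deg E (bh s)) +
   nunc_b1_extra q p E)); last first.
  by move=> q nzq Eq; rewrite cochain_bh // Ee Eq; ring.
rewrite lcombD; have := mix_bhat Hs p lin; rewrite {1}/pair_bhat.
under eq_lcomb => s do rewrite bh_bhat; rewrite lcomb0 => /esym/eqP.
rewrite addr_eq0 => /eqP ->.
rewrite (bhat_nunc_b1_extra nz); last by rewrite /E Ee; ring.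
under [X in _ + _ *: X]eq_lcomb => q do rewrite nunc_bE.
rewrite lcombD scalerDr addKr [RHS](_ : _ = 0) //.
have [one|none] := eqVneq (csize Hs) 1%N; last first.
  rewrite -(scaler0 _ (sgn (sdeg Hs))) -(lcomb0 _ (bhat p)); congr (_ *: _).
  by apply: eq_lcomb => q; rewrite nunc_b1_extra_long.
case: Hs one {nz Ee lin} @E => // f' {}g H Hs; case: Hs H => // H _ E.
under eq_lcomb => q do rewrite nunc_b1_extra_csing.
rewrite lcombZ bhat_bhat ?scaler0 //.
exact: cochain_app_lin.
Qed.

Fact nunc_stasheff : stasheff NuncAB.
Proof.
move=> f g Hs.
have E : deg Hs + (3 - (csize Hs)%:Z) = sdeg Hs + 3 by rewrite /sdeg; ring.
have := nunc_bar E; rewrite (bh_bhat_stasheff nunc_mh_lin) => /(congr1 ( *:%R (omega_sign Hs))).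
by rewrite scaler0 scalerA omegasq scale1r.
Qed.

Definition NuncCat : ainf_cat K :=
  @AinfCat K NuncAB nunc_mop_nil nunc_mh_lin nunc_stasheff.

End NuncCat.

(** * The relations between b_1, b_2 and b_3 *)

Section Operations.
Variables (K : fieldType) (D : ainf_ops K).

(** The target degree e is free: b_1 takes values in a degree that is only
    provably equal to d + 1. *)
Definition b1 d e (X Y : D) (x : gr_hom D X Y d) : gr_hom D X Y e :=
  at_deg e (bh (csing (hom_elt x))).

Definition b2 d1 d2 e (X Y Z : D) (y : gr_hom D Y Z d1) (x : gr_hom D X Y d2) :
    gr_hom D X Z e :=
  at_deg e (bh (ccons (hom_elt y) (csing (hom_elt x)))).

Definition b3 d1 d2 d3 e (X Y Z T : D) (z : gr_hom D Z T d1)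
    (y : gr_hom D Y Z d2) (x : gr_hom D X Y d3) : gr_hom D X T e :=
  at_deg e (bh (ccons (hom_elt z) (ccons (hom_elt y) (csing (hom_elt x))))).

Lemma b1_mh d e (X Y : D) (x : gr_hom D X Y d) :
  b1 e x = - at_deg e (mh (csing (hom_elt x))).
Proof. by rewrite /b1 at_deg_scale /= mulr0 mul1r scaleN1r. Qed.

Lemma b2_mh d1 d2 e (X Y Z : D) (y : gr_hom D Y Z d1) (x : gr_hom D X Y d2) :
  b2 e y x = sgn d1 *: at_deg e (mh (ccons (hom_elt y) (csing (hom_elt x)))).
Proof.
rewrite /b2 at_deg_scale /= (mulr1 (d1 - 1)) (mulr0 (d2 - 1)) !mulr1 -[_ ^ _]/(sgn _).
by rewrite sgnD sgnN1 mulrN1 opprK.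
Qed.

Lemma cycle0E (X Y : D) (x : gr_hom D X Y 0) : cycle0 x <-> b1 1 x = 0.
Proof.
have -> : b1 1 x = - mop D (csing (hom_elt x)).
  by rewrite b1_mh; congr (- _); exact: (at_deg_id (mop D (csing (hom_elt x)))).
by split=> [->|/eqP]; rewrite ?oppr0 // oppr_eq0 => /eqP.
Qed.

Lemma comp0E (X Y Z : D) (y : gr_hom D Y Z 0) (x : gr_hom D X Y 0) :
  comp0 y x = b2 0 y x.
Proof. by rewrite b2_mh scale1r. Qed.

End Operations.

Section Relations.
Variables (K : fieldType) (D : ainf_cat K).

Lemma b1P d e (X Y : D) k (x y : gr_hom D X Y d) :
  b1 e (k *: x + y) = k *: b1 e x + b1 e y.
Proof. exact: (mlin_elin (cnil _) (cnil _) (bh_mlin (@mop_lin K D) e)). Qed.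

Lemma b1D d e (X Y : D) (x y : gr_hom D X Y d) : b1 e (x + y) = b1 e x + b1 e y.
Proof. by rewrite -[x]scale1r b1P !scale1r. Qed.

Lemma b1_0 d e (X Y : D) : b1 e (0 : gr_hom D X Y d) = 0.
Proof. exact: (elin0 d (mlin_elin (cnil _) (cnil _) (bh_mlin (@mop_lin K D) e))). Qed.

Lemma b1N d e (X Y : D) (x : gr_hom D X Y d) : b1 e (- x) = - b1 e x.
Proof. by rewrite -scaleN1r -[_ *: x]addr0 b1P b1_0 addr0 scaleN1r. Qed.

Lemma b1B d e (X Y : D) (x y : gr_hom D X Y d) : b1 e (x - y) = b1 e x - b1 e y.
Proof. by rewrite b1D b1N. Qed.

Lemma homologousE (X Y : D) (x y : gr_hom D X Y 0) :
  homologous x y <-> exists z : gr_hom D X Y (-1), b1 0 z = x - y.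
Proof.
split=> [[z <-]|[z E]]; exists (- z); first by rewrite b1N b1_mh opprK.
by rewrite -E -[LHS]opprK -b1_mh b1N opprK.
Qed.

Section B2.
Variables (d1 d2 e : int) (X Y Z : D).
Implicit Types (y : gr_hom D Y Z d1) (x : gr_hom D X Y d2).

Lemma b2lP k y y' x : b2 e (k *: y + y') x = k *: b2 e y x + b2 e y' x.
Proof. exact: (mlin_elin (cnil _) (csing _) (bh_mlin (@mop_lin K D) e)). Qed.

Lemma b2rP k y x x' : b2 e y (k *: x + x') = k *: b2 e y x + b2 e y x'.
Proof. exact: (mlin_elin (csing _) (cnil _) (bh_mlin (@mop_lin K D) e)). Qed.

Lemma b2Dl y y' x : b2 e (y + y') x = b2 e y x + b2 e y' x.
Proof. by rewrite -[y]scale1r b2lP !scale1r. Qed.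

Lemma b2Dr y x x' : b2 e y (x + x') = b2 e y x + b2 e y x'.
Proof. by rewrite -[x]scale1r b2rP !scale1r. Qed.

Lemma b20l x : b2 e (0 : gr_hom D Y Z d1) x = 0.
Proof. exact: (elin0 d1 (mlin_elin (cnil _) (csing _) (bh_mlin (@mop_lin K D) e))). Qed.

Lemma b20r y : b2 e y (0 : gr_hom D X Y d2) = 0.
Proof. exact: (elin0 d2 (mlin_elin (csing _) (cnil _) (bh_mlin (@mop_lin K D) e))). Qed.

Lemma b2Nl y x : b2 e (- y) x = - b2 e y x.
Proof. by rewrite -scaleN1r -[_ *: y]addr0 b2lP b20l addr0 scaleN1r. Qed.

Lemma b2Nr y x : b2 e y (- x) = - b2 e y x.
Proof. by rewrite -scaleN1r -[_ *: x]addr0 b2rP b20r addr0 scaleN1r. Qed.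

Lemma b2Bl y y' x : b2 e (y - y') x = b2 e y x - b2 e y' x.
Proof. by rewrite b2Dl b2Nl. Qed.

Lemma b2Br y x x' : b2 e y (x - x') = b2 e y x - b2 e y x'.
Proof. by rewrite b2Dr b2Nr. Qed.

End B2.

Lemma b30m d1 d2 d3 e (X Y Z T : D) (z : gr_hom D Z T d1) (x : gr_hom D X Y d3) :
  b3 e z (0 : gr_hom D Y Z d2) x = 0.
Proof. 
exact: (elin0 d2 (mlin_elin (csing _) (csing _) (bh_mlin (@mop_lin K D) e))).
Qed.

Lemma b30r d1 d2 d3 e (X Y Z T : D) (z : gr_hom D Z T d1) (y : gr_hom D Y Z d2) :
  b3 e z y (0 : gr_hom D X Y d3) = 0.
Proof. 
exact: (elin0 d3 (mlin_elin (ccons _ (csing _)) (cnil _) (bh_mlin (@mop_lin K D) e))).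
Qed.

Lemma b30l d1 d2 d3 e (X Y Z T : D) (y : gr_hom D Y Z d2) (x : gr_hom D X Y d3) :
  b3 e (0 : gr_hom D Z T d1) y x = 0.
Proof. 
exact: (elin0 d1 (mlin_elin (cnil _) (ccons _ (csing _)) (bh_mlin (@mop_lin K D) e))).
Qed.

Lemma b1_elt d e (X Y : D) (x : gr_hom D X Y d) :
  e = d + 1 -> bh (csing (hom_elt x)) = hom_elt (b1 e x).
Proof. by move=> ->; rewrite hom_elt_at_deg // /=; ring. Qed.

Lemma b2_elt d1 d2 e (X Y Z : D) (y : gr_hom D Y Z d1) (x : gr_hom D X Y d2) :
  e = d1 + d2 -> bh (ccons (hom_elt y) (csing (hom_elt x))) = hom_elt (b2 e y x).
Proof. by move=> ->; rewrite hom_elt_at_deg // /=; ring. Qed.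

Lemma b3_elt d1 d2 d3 e (X Y Z T : D) (z : gr_hom D Z T d1)
    (y : gr_hom D Y Z d2) (x : gr_hom D X Y d3) :
  e = d1 + d2 + d3 - 1 ->
  bh (ccons (hom_elt z) (ccons (hom_elt y) (csing (hom_elt x)))) =
  hom_elt (b3 e z y x).
Proof. by move=> ->; rewrite hom_elt_at_deg // /=; ring. Qed.

Lemma b1b1 d d' e (X Y : D) (x : gr_hom D X Y d) :
  d' = d + 1 -> b1 e (b1 d' x) = 0.
Proof.
move=> E; rewrite -(bh_bhat (csing (hom_elt x)) e) bhat_cons csum_nil bhat_nil.
by rewrite scaler0 addr0 (b1_elt x E).
Qed.

(** The degrees are variables tied by equations, so that the relation applies
    verbatim to numerical degrees. *)
Lemma b1b2 d1 d2 d1' d2' d12 e (X Y Z : D)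
    (y : gr_hom D Y Z d1) (x : gr_hom D X Y d2) :
  d1' = d1 + 1 -> d2' = d2 + 1 -> d12 = d1 + d2 ->
  b1 e (b2 d12 y x) + b2 e (b1 d1' y) x + sgn (d1 - 1) *: b2 e y (b1 d2' x) = 0.
Proof.
move=> E1 E2 E12.
rewrite -(bh_bhat (ccons (hom_elt y) (csing (hom_elt x))) e).
rewrite !(bhat_cons, csum_cons, csum_nil, bhat_nil) scaler0 addr0.
rewrite (b2_elt y x E12) (b1_elt y E1) (b1_elt x E2).
by congr (_ + _); rewrite addrC.
Qed.

Lemma b1b3 d1 d2 d3 d1' d2' d3' d12 d23 d123 e (X Y Z T : D)
    (z : gr_hom D Z T d1) (y : gr_hom D Y Z d2) (x : gr_hom D X Y d3) :
  d1' = d1 + 1 -> d2' = d2 + 1 -> d3' = d3 + 1 -> d12 = d1 + d2 ->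
  d23 = d2 + d3 -> d123 = d1 + d2 + d3 - 1 ->
  b1 e (b3 d123 z y x) + b2 e (b2 d12 z y) x
  + sgn (d1 - 1) *: b2 e z (b2 d23 y x)
  + b3 e (b1 d1' z) y x + sgn (d1 - 1) *: b3 e z (b1 d2' y) x
  + sgn (d1 + d2) *: b3 e z y (b1 d3' x) = 0.
Proof.
move=> E1 E2 E3 E12 E23 E123.
rewrite -(bh_bhat (ccons (hom_elt z) (ccons (hom_elt y) (csing (hom_elt x)))) e).
rewrite !(bhat_cons, csum_cons, csum_nil, bhat_nil) scaler0 addr0.
rewrite (b3_elt z y x E123) (b2_elt z y E12) (b2_elt y x E23).
rewrite (b1_elt z E1) (b1_elt y E2) (b1_elt x E3).
rewrite /= !scalerDr scalerA -[sgn _ * sgn _]sgnD.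
rewrite (@eq_sgn K (-1) (d1 - 1 + (d2 - 1)) (d1 + d2)); last by ring.
rewrite -/(b3 e (b1 d1' z) y x) -/(b3 e z (b1 d2' y) x) -/(b3 e z y (b1 d3' x)).
rewrite -/(b2 e (b2 d12 z y) x) -/(b2 e z (b2 d23 y x)) -/(b1 e (b3 d123 z y x)).
by rewrite !addrA; rewrite [LHS](ACl (4*2*1*5*3*6)).
Qed.

Lemma b2_cycle_b1 d d1 d' (X Y Z : D) (y : gr_hom D Y Z 0) (x : gr_hom D X Y d) :
  d1 = d + 1 -> d' = d -> b1 1 y = 0 -> b2 d1 y (b1 d1 x) = b1 d1 (b2 d' y x).
Proof.
move=> E1 E' cy; have := @b1b2 0 d 1 d1 d' d1 X Y Z y x.
rewrite !add0r => /(_ erefl E1 E'); rewrite cy b20l addr0 sgnN1 scaleN1r.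
by move/eqP; rewrite subr_eq0 => /eqP ->.
Qed.

Lemma b2_b1_cycle d d1 (X Y Z : D) (y : gr_hom D Y Z d) (x : gr_hom D X Y 0) :
  d1 = d + 1 -> b1 1 x = 0 -> b2 d1 (b1 d1 y) x = - b1 d1 (b2 d y x).
Proof.
move=> E1 cx; have := @b1b2 d 0 d1 1 d d1 X Y Z y x.
rewrite addr0 cx b20r scaler0 addr0 => /(_ E1 erefl erefl)/eqP.
by rewrite addrC addr_eq0 => /eqP ->.
Qed.

Section Inverses.
Variable one : forall X : D, gr_hom D X X 0.
Hypothesis one_l : forall X Y (x : gr_hom D X Y 0), b2 0 (one Y) x = x.
Hypothesis one_r : forall X Y (x : gr_hom D X Y 0), b2 0 x (one X) = x.

(** l and r are both homotopic to l x r; b_3(l, x, r) is the homotopy between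
    the two ways of bracketing it. *)
Lemma inverses_homologous (X Y : D) (x : gr_hom D X Y 0) (l r : gr_hom D Y X 0) :
  cycle0 x -> cycle0 l -> cycle0 r ->
  homologous (comp0 l x) (one X) -> homologous (comp0 x r) (one Y) ->
  homologous l r.
Proof.
rewrite !comp0E => /cycle0E cx /cycle0E cl /cycle0E cr.
move=> /homologousE[s Es] /homologousE[w Ew]; apply/homologousE.
have := @b1b3 0 0 0 1 1 1 0 0 (-1) 0 Y X Y X l x r erefl erefl erefl erefl erefl erefl.
rewrite cx cl cr b30l b30m b30r !scaler0 !addr0 sgnN1 scaleN1r.
have -> : b2 0 l x = b1 0 s + one X by rewrite Es subrK.
have -> : b2 0 x r = b1 0 w + one Y by rewrite Ew subrK.
rewrite b2Dl b2Dr one_l one_r (b2_b1_cycle (d1 := 0) s erefl cr).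
rewrite (b2_cycle_b1 (d1 := 0) w erefl erefl cl) => E.
exists (b3 (-1) l x r - b2 (-1) s r - b2 (-1) l w).
rewrite !b1B; apply/eqP; rewrite -subr_eq0 -[X in _ == X]E !opprD opprK.
by apply/eqP; rewrite !addrA [LHS](ACl (1*2*5*3*4)).
Qed.

End Inverses.

End Relations.

(** * The units of the category of functors *)

Section NuncUnits.
Variables (K : fieldType) (A B : ainf_cat K).
Local Notation N := (nunc_quiver A B).
Local Notation NuncAB := (Nunc A B).

Lemma mix_cnil_pos (W : lmodType K) (f : N) X Z (p : gchain A X Z)
    (Phi : gchain B (f X) (f Z) -> W) :
  csize p != 0%N -> (forall q, csize q != 0%N -> Phi q = 0) ->
  lcomb (mix (cnil f) p) Phi = 0.
Proof.
rewrite mix_cnil; case: p Phi => // Y {}Z x p Phi _ E.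
rewrite Fhat_cons -[RHS](csum0 _ p); apply: eq_csum => U l r _.
by rewrite big1 // => q _; rewrite E.
Qed.

Lemma mix_cnil_nil (W : lmodType K) (f : N) (X : A)
    (Phi : gchain B (f X) (f X) -> W) :
  lcomb (mix (cnil f) (cnil X)) Phi = Phi (cnil (f X)).
Proof. by rewrite mix_cnil big_seq1. Qed.

Lemma mix_csing (W : lmodType K) (f g : N) (H : edge f g) X Z (p : gchain A X Z)
    (Phi : gchain B (f X) (g Z) -> W) :
  lcomb (mix (csing H) p) Phi =
  csum p (fun V l q => csum q (fun U m r =>
    sgn ((tag H - 1) * sdeg l) *:
    lcomb (mix (cnil g) l) (fun q => lcomb (mix (cnil f) r) (fun s =>
      Phi (ccat q (ccons (cochain_app H m) s)))))).
Proof.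
rewrite mix_ccons; apply: eq_csum => V l q _; apply: eq_csum => U m r _.
by rewrite mul0r addr0.
Qed.

(** Every component of f or g adds a letter, so a functional that vanishes on
    chains of length other than one only sees the cut where H takes all of p. *)
Lemma mix_csing_alone (W : lmodType K) (f g : N) (H : edge f g) X Z (p : gchain A X Z)
    (Phi : gchain B (f X) (g Z) -> W) :
  (forall q, csize q != 1%N -> Phi q = 0) ->
  lcomb (mix (csing H) p) Phi = Phi (csing (cochain_app H p)).
Proof.
move=> E; rewrite mix_csing csum_first => [|V l q nz]; last first.
  rewrite -[RHS](csum0 _ q); apply: eq_csum => U m r _.
  rewrite mix_cnil_pos ?scaler0 // => s1 nz1.
  rewrite -[RHS](lcomb0 _ (mix (cnil f) r)); apply: eq_lcomb => s2.
  by rewrite E // csize_cat /=; lia.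
rewrite csum_last => [|U m r nz]; last first.
  rewrite mix_cnil_nil mix_cnil_pos ?scaler0 // => s nzs.
  by rewrite E //= eqSS.
by rewrite mulr0 scale1r !mix_cnil_nil.
Qed.

Variable oneB : forall X : B, gr_hom B X X 0.

(** The unit of g is concentrated on the empty chain, so it is inserted
    between two neighbouring pieces of p. *)
Lemma mix_one (W : lmodType K) (f g : N) (Hs : gchain N f g) X Z (p : gchain A X Z)
    (Phi : gchain B (f X) (g Z) -> W) :
  mlin_at Phi ->
  lcomb (mix (ccons (hom_elt (nunc_one oneB g : gr_hom N g g 0)) Hs) p) Phi =
  csum p (fun V l r => sgn (- sdeg l + sdeg Hs * sdeg l) *:
    lcomb (mix (cnil g) l) (fun q => lcomb (mix Hs r) (fun s =>
      Phi (ccat q (ccons (hom_elt (oneB (g V))) s))))).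
Proof.
move=> h; rewrite mix_ccons; apply: eq_csum => V l q _.
rewrite csum_first => [|U m r nz].
  by rewrite /= add0r mulN1r addr0.
rewrite [lcomb _ _](_ : _ = 0) ?scaler0 // -[RHS](lcomb0 _ (mix (cnil g) l)).
apply: eq_lcomb => s1; rewrite -[RHS](lcomb0 _ (mix Hs r)); apply: eq_lcomb => s2.
by apply: (elin_tag0 (mlin_elin s1 s2 h)); case: m nz.
Qed.

Hypothesis hB : strictly_unital oneB.

Lemma bh_one X Y Z (l : gchain B Y Z) (r : gchain B X Y) e :
  (csize l + csize r != 1)%N ->
  at_deg e (bh (ccat l (ccons (hom_elt (oneB Y)) r))) = 0.
Proof.
case: hB => _ _ h nz; apply: elin_tag0; first exact: elin_at_deg.
by rewrite /= h // scaler0.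
Qed.

Lemma bh_one_l X Y (x : edge X Y) :
  bh (ccons (hom_elt (oneB Y)) (csing x)) = x.
Proof.
case: hB => h _ _; rewrite /bh h /= (mulr0 (tag x - 1)) !mulr1 -/(sgn _) sgnN1 opprK.
by case: x => d x; rewrite /hscale /= scale1r.
Qed.

Lemma bh_one_r X Y (x : edge X Y) :
  bh (ccons x (csing (hom_elt (oneB X)))) = hscale (sgn (tag x)) x.
Proof.
case: hB => _ h _; rewrite /bh h /= !mulr1 -/(sgn _) sgnD sgnN1.
by rewrite mulrN1 opprK.
Qed.

(** Strict unitality of B leaves only the term without components of f and g. *)
Lemma nunc_one_l (f g : NuncAB) d (x : gr_hom NuncAB f g d) :
  b2 d (nunc_one oneB g) x = x.
Proof.
apply: cochain_ext => X Z p; rewrite cochain_bh //; last first.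
  by rewrite sdeg_cons sdeg_cons sdeg_nil /=; ring.
rewrite nunc_bE nunc_b1_extra_long // addr0 mix_one; last exact: bh_lin.
rewrite csum_first => [|V l r nz]; last first.
  rewrite mix_cnil_pos ?scaler0 // => s1 nz1.
  rewrite mix_csing -[RHS](csum0 _ r); apply: eq_csum => T l' q _.
  rewrite -[RHS](csum0 _ q); apply: eq_csum => U m r' _.
  rewrite [lcomb _ _](_ : _ = 0) ?scaler0 // -[RHS](lcomb0 _ (mix (cnil g) l')).
  apply: eq_lcomb => s2; rewrite -[RHS](lcomb0 _ (mix (cnil f) r')); apply: eq_lcomb => s3.
  by rewrite bh_one // csize_cat /=; lia.
rewrite oppr0 mulr0 add0r scale1r mix_cnil_nil mix_csing_alone => [|q nz].
  by rewrite /= bh_one_l at_deg_id.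
exact: (bh_one (l := cnil _)).
Qed.

Lemma nunc_one_r (f g : NuncAB) d (x : gr_hom NuncAB f g d) :
  b2 d x (nunc_one oneB f) = sgn d *: x.
Proof.
apply: cochain_ext => X Z p; rewrite cochainZE cochain_bh //; last first.
  by rewrite sdeg_cons sdeg_cons sdeg_nil /=; ring.
rewrite nunc_bE nunc_b1_extra_long // addr0 mix_ccons.
set E := sdeg p + d.
have lin : mlin_at (fun s : gchain B (f X) (g Z) => at_deg E (bh s)).
  exact: bh_lin.
have inner V U (q : gchain B (g V) (g Z)) (m : gchain A U V) (r : gchain A X U) :
    (csize q + csize r != 0)%N ->
    lcomb (mix (csing (hom_elt (nunc_one oneB f : gr_hom N f f 0))) r) (fun s =>
      at_deg E (bh (ccat q (ccons (cochain_app (hom_elt (x : gr_hom N f g d)) m) s)))) = 0.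
  move=> nz; rewrite mix_one; last first.
    exact: (mlin_ccons (Phi := fun s => at_deg E (bh (ccat q s))) _ (mlin_ccatr _ lin)).
  rewrite -[RHS](csum0 _ r); apply: eq_csum => T l' r' Er.
  have z s1 s2 : (csize q + csize s1 + csize s2 != 0)%N ->
      at_deg E (bh (ccat q (ccons (cochain_app (hom_elt (x : gr_hom N f g d)) m)
        (ccat s1 (ccons (hom_elt (oneB (f T))) s2))))) = 0.
    move=> nz'; rewrite -[ccons _ (ccat _ _)]/(ccat (ccons _ s1) _) ccatA bh_one //.
    by rewrite csize_cat /=; lia.
  have [ql|ql] := eqVneq (csize l') 0%N; last first.
    rewrite mix_cnil_pos ?scaler0 // => s1 nz1.
    rewrite -[RHS](lcomb0 _ (mix (cnil f) r')); apply: eq_lcomb => s2.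
    by apply: z; lia.
  rewrite [lcomb _ _](_ : _ = 0) ?scaler0 // -[RHS](lcomb0 _ (mix (cnil f) l')).
  apply: eq_lcomb => s1.
  have [qq|qq] := eqVneq (csize q) 0%N; last first.
    rewrite -[RHS](lcomb0 _ (mix (cnil f) r')); apply: eq_lcomb => s2.
    by apply: z; lia.
  rewrite mix_cnil_pos // => [|s2 nz2]; last by apply: z; lia.
  by move: nz; rewrite -Er csize_cat qq ql.
rewrite csum_first => [|V l q nz]; last first.
  rewrite -[RHS](csum0 _ q); apply: eq_csum => U m r _.
  by rewrite mix_cnil_pos ?scaler0 // => s1 nz1; rewrite inner //; lia.
rewrite csum_last => [|U m r nz]; last first.
  by rewrite mix_cnil_nil inner ?scaler0 //=; lia.
rewrite mix_cnil_nil mix_one; last first.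
  exact: (mlin_ccons (Phi := fun s => at_deg E (bh (ccat (cnil _) s))) _ lin).
rewrite csum_nil !mix_cnil_nil /= bh_one_r at_deg_scale at_deg_id.
rewrite !scalerA -!sgnD; congr (_ *: _).
rewrite sdeg_cons !sdeg_nil /=; apply: (@eq_sgn K 0); ring.
Qed.

End NuncUnits.

(** * Filtration by length and evaluation on empty chains *)

Section Filtration.
Variables (K : fieldType) (A B : ainf_cat K).
Local Notation N := (nunc_quiver A B).
Local Notation NuncAB := (NuncCat A B).

Definition vanish k (f g : N) d (H : gr_hom N f g d) : Prop :=
  forall X Z (p : gchain A X Z), (csize p < k)%N -> cochain_val H p = 0.

(** A lower bound for the filtration of a tensor of cochains: the sum of the
    filtrations of the factors. *)
Inductive filtered_chain (f : N) : forall g, gchain N f g -> nat -> Prop :=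
| filtered_nil : filtered_chain (cnil f) 0
| filtered_cons f' g (H : edge f' g) (Hs : gchain N f f') k n :
    vanish k (tagged H) -> filtered_chain Hs n -> filtered_chain (ccons H Hs) (k + n).

(** If a chain is shorter than the total filtration, one of the cochains
    receives a piece on which it vanishes. *)
Lemma mix_filtered (W : lmodType K) (f g : N) (Hs : gchain N f g) n :
  filtered_chain Hs n -> forall X Z (p : gchain A X Z) (Phi : gchain B (f X) (g Z) -> W),
  (csize p < n)%N -> mlin_at Phi -> lcomb (mix Hs p) Phi = 0.
Proof.
elim=> [//|f' {}g H {}Hs k {}n vH _ IH] X Z p Phi szp h.
rewrite mix_ccons -[RHS](csum0 _ p); apply: eq_csum => V l q Ep.
rewrite -[RHS](csum0 _ q); apply: eq_csum => U m r Eq.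
rewrite [lcomb _ _](_ : _ = 0) ?scaler0 // -[RHS](lcomb0 _ (mix (cnil g) l)).
apply: eq_lcomb => s1; have [szm|szm] := ltnP (csize m) k.
  rewrite -[RHS](lcomb0 _ (mix Hs r)); apply: eq_lcomb => s2.
  by apply: (elin_tag0 (mlin_elin s1 s2 h)); apply: vH.
apply: (IH _ _ _ (fun s => Phi (ccat s1 (ccons (cochain_app H m) s)))).
  by move: szp; rewrite -Ep -Eq !csize_cat; lia.
exact: (mlin_ccons (Phi := fun s => Phi (ccat s1 s)) _ (mlin_ccatr _ h)).
Qed.

Lemma bhat_short (D : ainf_ops K) (W : lmodType K) (X Z : D) (p : gchain D X Z)
    (Phi : gchain D X Z -> W) :
  (forall q, (csize q <= csize p)%N -> Phi q = 0) -> lcomb (bhat p) Phi = 0.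
Proof.
move=> E; rewrite lcomb_bhat -[RHS](csum0 _ p); apply: eq_csum => V l q Ep.
rewrite -[RHS](csum0 _ q); apply: eq_csum => U m r Eq.
case: ifP => // nz; rewrite E ?scaler0 //.
by rewrite -Ep -Eq !csize_cat /=; lia.
Qed.

Lemma vanish_bh (f g : N) (Hs : gchain NuncAB f g) n e :
  filtered_chain Hs n -> vanish n (at_deg e (bh Hs)).
Proof.
move=> v X Z p szp; rewrite at_deg_scale cochainZE cochain_at_deg.
case: ifP => _; rewrite ?scaler0 // /nunc_val; case: ifP => _; rewrite ?scaler0 //.
rewrite nunc_bE (mix_filtered v) //; last exact: bh_lin.
rewrite add0r [X in _ *: (_ *: X)](_ : _ = 0) ?scaler0 //.
case: v szp => [//|f' {}g H {}Hs k {}n vH v].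
case: v H vH => [|f1 f2 H1 Hs1 k1 n1 _ _] H vH szp; last by rewrite nunc_b1_extra_long.
rewrite nunc_b1_extra_csing bhat_short ?scaler0 // => q szq.
rewrite /cochain_app vH ?at_deg0 //; lia.
Qed.

Lemma vanish0 (f g : N) d (x : gr_hom N f g d) : vanish 0 x.
Proof. by []. Qed.

Lemma vanishW i j (f g : N) d (x : gr_hom N f g d) : (j <= i)%N -> vanish i x -> vanish j x.
Proof. by move=> le v X Z p szp; apply: v; lia. Qed.

Lemma vanishD i (f g : N) d (x y : gr_hom N f g d) : vanish i x -> vanish i y -> vanish i (x + y).
Proof. by move=> vx vy X Z p szp; rewrite cochainDE vx // vy // addr0. Qed.

Lemma vanishN i (f g : N) d (x : gr_hom N f g d) : vanish i x -> vanish i (- x).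
Proof. by move=> vx X Z p szp; rewrite -scaleN1r cochainZE vx // scaler0. Qed.

Lemma vanishB i (f g : N) d (x y : gr_hom N f g d) : vanish i x -> vanish i y -> vanish i (x - y).
Proof. by move=> vx vy; apply: vanishD => //; apply: vanishN. Qed.

Section Vanish.
Variables (f g h k : N).

Lemma vanish_b1 i d e (x : gr_hom NuncAB f g d) : vanish i x -> vanish i (b1 e x).
Proof.
move=> v; rewrite -(addn0 i); apply: vanish_bh.
exact: (@filtered_cons f f g (hom_elt (x : gr_hom N f g d)) _ i 0 v (filtered_nil f)).
Qed.

Lemma vanish_b2 i j m d1 d2 e (y : gr_hom NuncAB g h d1) (x : gr_hom NuncAB f g d2) :
  vanish i y -> vanish j x -> (m <= i + j)%N -> vanish m (b2 e y x).
Proof.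
move=> vy vx le; apply: (vanishW le); rewrite -[j]addn0.
apply: vanish_bh.
apply: (@filtered_cons f g h (hom_elt (y : gr_hom N g h d1)) _ i _ vy).
exact: (@filtered_cons f f g (hom_elt (x : gr_hom N f g d2)) _ j 0 vx (filtered_nil f)).
Qed.

Lemma vanish_b3 i j l m d1 d2 d3 e (z : gr_hom NuncAB h k d1) (y : gr_hom NuncAB g h d2)
    (x : gr_hom NuncAB f g d3) :
  vanish i z -> vanish j y -> vanish l x -> (m <= i + j + l)%N ->
  vanish m (b3 e z y x).
Proof.
move=> vz vy vx le; apply: (vanishW le); rewrite -addnA -[l]addn0.
apply: vanish_bh.
apply: (@filtered_cons f h k (hom_elt (z : gr_hom N h k d1)) _ i _ vz).
apply: (@filtered_cons f g h (hom_elt (y : gr_hom N g h d2)) _ j _ vy).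
exact: (@filtered_cons f f g (hom_elt (x : gr_hom N f g d3)) _ l 0 vx (filtered_nil f)).
Qed.

End Vanish.

Definition point_val (f g : N) d (y : forall X : A, gr_hom B (f X) (g X) d)
    X Z (p : gchain A X Z) : gr_hom B (f X) (g Z) (sdeg p + d) :=
  match p in chain _ _ Z0 return gr_hom B (f X) (g Z0) (sdeg p + d) with
  | cnil => at_deg _ (hom_elt (y X))
  | ccons _ _ _ _ => 0
  end.

Fact point_lin (f g : N) d y :
  multilinear (fun (X Z : A) p => hom_elt (@point_val f g d y X Z p)).
Proof.
move=> X Z e Y Y' l r c k x z.
by case: l x z => [|S S' u l] x z /=; rewrite !at_deg0 scaler0 addr0.
Qed.

Definition point_cochain (f g : N) d y : gr_hom N f g d :=
  @Cochain K A B f g d (point_val y) (@point_lin f g d y).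

Definition eval_at_nil (X : A) (f g : N) (H : edge f g) : edge (f X) (g X) :=
  cochain_app H (cnil X).

Lemma mix_at_nil (W : lmodType K) (f g : N) (Hs : gchain N f g) X
    (Phi : gchain B (f X) (g X) -> W) :
  lcomb (mix Hs (cnil X)) Phi = Phi (cmap (phi := fun f : N => f X) (@eval_at_nil X) Hs).
Proof.
elim: Hs Phi => [|f' {}g H Hs IH] Phi; first by rewrite mix_cnil_nil.
by rewrite mix_ccons !csum_nil !sdeg_nil addr0 !mulr0 addr0 scale1r mix_cnil_nil IH.
Qed.

Lemma bh_at_nil (f g : N) (Hs : gchain NuncAB f g) e X :
  csize Hs != 0%N -> e = sdeg Hs + 2 ->
  cochain_val (at_deg e (bh Hs)) (cnil X) =
  at_deg (sdeg (cnil X : gchain A X X) + e)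
    (bh (cmap (phi := fun f : N => f X) (@eval_at_nil X) Hs)).
Proof.
move=> nz E; rewrite cochain_bh // nunc_bE mix_at_nil.
rewrite [nunc_b1_extra _ _ _](_ : _ = 0) ?[LHS]addr0 //.
have [one|none] := eqVneq (csize Hs) 1%N; last by rewrite nunc_b1_extra_long.
case: Hs one {nz E} => // f' {}g H Hs; case: Hs H => // H _.
by rewrite nunc_b1_extra_csing bhat_nil scaler0.
Qed.

Lemma vanish1 (f g : N) d (x : gr_hom N f g d) :
  (forall X, cochain_val x (cnil X) = 0) -> vanish 1 x.
Proof. by move=> E X Z p; case: p. Qed.

Lemma b1_at_nil (f g : N) (x : gr_hom NuncAB f g 0) X :
  cochain_val (b1 1 x) (cnil X) = b1 1 (zero_component x X).
Proof. exact: (@bh_at_nil f g (csing (hom_elt x)) 1 X isT erefl). Qed.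

Lemma b2_at_nil (f g h : N) (y : gr_hom NuncAB g h 0) (x : gr_hom NuncAB f g 0) X :
  zero_component (b2 0 y x) X = b2 0 (zero_component y X) (zero_component x X).
Proof.
exact: (@bh_at_nil f h (ccons (hom_elt y) (csing (hom_elt x))) 0 X isT erefl).
Qed.

Lemma b1_at_nil_htpy (f g : N) (x : gr_hom NuncAB f g (-1)) X :
  zero_component (b1 0 x) X = b1 0 (cochain_val x (cnil X) : gr_hom B (f X) (g X) (-1)).
Proof. exact: (@bh_at_nil f g (csing (hom_elt x)) 0 X isT erefl). Qed.

Lemma point_at_nil (f g : N) (y : forall X : A, gr_hom B (f X) (g X) 0) X :
  zero_component (point_cochain y) X = y X.
Proof. exact: at_deg_id. Qed.

Lemma point_at_nil_htpy (f g : N) (y : forall X : A, gr_hom B (f X) (g X) (-1)) X :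
  cochain_val (point_cochain y) (cnil X) = y X.
Proof. exact: at_deg_id. Qed.

End Filtration.

(** * Right inverses by successive approximation *)

Section Limit.
Variables (K : fieldType) (A B : ainf_cat K) (f g : nunc_quiver A B) (d : int).
Local Notation N := (nunc_quiver A B).

Definition stable_sum_val (v : nat -> gr_hom N f g d) X Z (p : gchain A X Z) :
    gr_hom B (f X) (g Z) (sdeg p + d) :=
  \sum_(j < (csize p).+1.*2) cochain_val (v j) p.

Fact stable_sum_lin v :
  multilinear (fun (X Z : A) (p : gchain A X Z) => hom_elt (stable_sum_val v p)).
Proof.
have E X Z (p : gchain A X Z) e : at_deg e (hom_elt (stable_sum_val v p)) =
    \sum_(j < (csize p).+1.*2) at_deg e (cochain_app (hom_elt (v j)) p).
  rewrite /stable_sum_val; elim/big_rec2: _ => [|j x y _ IH]; first by rewrite at_deg0.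
  rewrite -IH -[cochain_val (v j) p + y]/(_ + y) -[cochain_val (v j) p]scale1r.
  by rewrite at_degD !scale1r.
move=> X Z e Y Y' l r c k x y; rewrite !E.
rewrite (csize_inv l r (k *: x + y) y) (csize_inv l r x y) scaler_sumr -big_split.
by apply: eq_bigr => j _; apply: cochain_app_lin.
Qed.

(** The sum of all v_j, for a sequence v_j of filtration at least j / 2: on a
    chain of length n the terms with j >= 2 (n + 1) vanish. *)
Definition stable_sum (v : nat -> gr_hom N f g d) : gr_hom N f g d :=
  @Cochain K A B f g d (@stable_sum_val v) (stable_sum_lin v).

Lemma cochain_sumE (I : Type) (s : seq I) (v : I -> gr_hom N f g d) X Z (p : gchain A X Z) :
  cochain_val (\sum_(j <- s) v j) p = \sum_(j <- s) cochain_val (v j) p.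
Proof.
elim: s => [|j s IH]; first by rewrite !big_nil.
by rewrite !big_cons cochainDE IH.
Qed.

Lemma stable_sum_approx v n :
  (forall j, vanish j./2 (v j)) -> vanish n (stable_sum v - \sum_(j < n.*2) v j).
Proof.
move=> h X Z p szp; rewrite cochainDE -scaleN1r cochainZE scaleN1r.
rewrite cochain_sumE; apply/eqP; rewrite subr_eq0; apply/eqP.
rewrite -[LHS]/(stable_sum_val v p) /stable_sum_val.
rewrite -(big_mkord xpredT (fun j => cochain_val (v j) p)).
rewrite -(big_mkord xpredT (fun j => cochain_val (v j) p)).
rewrite [RHS](big_cat_nat (n := (csize p).+1.*2)) //=; last by rewrite leq_double.
rewrite [X in _ = _ + X]big_nat_cond [X in _ = _ + X]big1 ?addr0 // => j /andP[/andP[le _] _].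
by apply: h; move: le; rewrite -[in X in X -> _](odd_double_half j); lia.
Qed.

End Limit.

Section Cone.
Variables (K : fieldType) (A B : ainf_cat K).
Variable oneB : forall X : B, gr_hom B X X 0.
Hypothesis hB : strictly_unital oneB.
Local Notation N := (nunc_quiver A B).
Local Notation NuncAB := (NuncCat A B).
Local Notation one := (nunc_one oneB).

(** Formal: the relation for (id, id) reads b_1(id) - b_1(id) - b_1(id) = 0. *)
Lemma one_cycle (f : NuncAB) : b1 1 (one f : gr_hom NuncAB f f 0) = 0.
Proof.
have := @b1b2 K NuncAB 0 0 1 1 0 1 f f f (one f) (one f) erefl erefl erefl.
rewrite (nunc_one_l hB (one f : gr_hom (Nunc A B) f f 0)).
rewrite (nunc_one_l hB (b1 1 (one f : gr_hom (Nunc A B) f f 0))).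
rewrite (nunc_one_r hB (b1 1 (one f : gr_hom (Nunc A B) f f 0))).
by rewrite sgn1 sgnN1 !scaleN1r addrN add0r => /eqP; rewrite oppr_eq0 => /eqP.
Qed.

Variables (f g : NuncAB) (H : gr_hom NuncAB f g 0) (G0 : gr_hom NuncAB g f 0).
Variables (t : gr_hom NuncAB f f (-1)) (t' : gr_hom NuncAB g g (-1)).
Hypothesis cH : b1 1 H = 0.
Let eps : gr_hom NuncAB f f 0 := b2 0 G0 H - one f - b1 0 t.
Let eps' : gr_hom NuncAB g g 0 := b2 0 H G0 - one g - b1 0 t'.
Hypotheses (vG : vanish 1 (b1 1 G0)) (veps : vanish 1 eps) (veps' : vanish 1 eps').

Implicit Types (e : gr_hom NuncAB g f 1) (u : gr_hom NuncAB g g 0).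

(** The pair (e, u) is a cycle of the cone of b_2(H, -) : Hom(g, f) -> Hom(g, g). *)
Definition cone_cycle e u := b1 2 e = 0 /\ b1 1 u = b2 1 H e.

(** The contraction of the cone sends (e, u) to (dstep e u, tstep u).  It is
    modelled on composition with G0, corrected by the homotopies t and t' and
    by the associativity homotopies b_3. *)
Definition dstep e u : gr_hom NuncAB g f 0 := b2 0 G0 u - b3 0 G0 H e + b2 0 t e.
Definition tstep u : gr_hom NuncAB g g (-1) := b2 (-1) t' u - b3 (-1) H G0 u.

Definition estep e u : gr_hom NuncAB g f 1 := e - b1 1 (dstep e u).
Definition ustep e u : gr_hom NuncAB g g 0 := u - b2 0 H (dstep e u) - b1 0 (tstep u).

Lemma cone_step e u : cone_cycle e u -> cone_cycle (estep e u) (ustep e u).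
Proof.
case=> ce cu; split.
  by rewrite b1B ce (@b1b1 _ NuncAB 0 1 2) // subr0.
rewrite /ustep b1B b1B (@b1b1 _ NuncAB (-1) 0 1) // subr0 cu b2Br.
by rewrite (@b2_cycle_b1 _ NuncAB 0 1 0).
Qed.

(** Relations used: b_1 b_2 on (G0, u) and (t, e), and b_1 b_3 on (G0, H, e).
    Each remaining term contains b_1 G0 or eps. *)
Lemma estepE e u : cone_cycle e u ->
  estep e u = b2 1 (b1 1 G0) u - b2 1 eps e - b3 1 (b1 1 G0) H e.
Proof.
case=> ce cu.
have E1 := @b1b2 K NuncAB 0 0 1 1 0 1 _ _ _ G0 u erefl erefl erefl.
have E2 := @b1b3 K NuncAB 0 0 1 1 1 2 0 1 0 1 _ _ _ _ G0 H e erefl erefl erefl erefl erefl erefl.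
have E3 := @b1b2 K NuncAB (-1) 1 0 2 0 1 _ _ _ t e erefl erefl erefl.
rewrite cu sgnN1 scaleN1r in E1.
rewrite cH ce b30m b30r !scaler0 !addr0 sgnN1 scaleN1r in E2.
rewrite ce b20r scaler0 addr0 in E3.
have E4 : b2 0 G0 H = eps + one f + b1 0 t.
  by rewrite /eps addrAC !subrK.
rewrite E4 b2Dl b2Dl (nunc_one_l hB e) in E2.
rewrite /estep /dstep b1D b1B.
move: E1 E2 E3; rewrite -addrA => /eqP; rewrite addr_eq0 => /eqP->.
rewrite -!addrA => /eqP; rewrite addr_eq0 => /eqP->.
move=> /eqP; rewrite addr_eq0 => /eqP->.
set p := b2 1 (b1 1 G0) u; set q := b2 1 G0 _; set s := b2 1 (b1 0 t) e.
set v := b2 1 eps e; set w := b3 1 _ _ _.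
(* the parentheses collect the cancelling pairs *)
rewrite !(opprD, opprK) !addrA. rewrite [LHS](ACl (2*4*8*(1*5)*(3*7)*(6*9))).
by rewrite /= !(addrN, addNr, addr0).
Qed.

(** In contrast to [estepE], the terms in e do not have higher filtration: the
    contraction is only one up to a map from e to u, whose square is zero. *)
Lemma ustepE e u : cone_cycle e u ->
  ustep e u = b3 0 H (b1 1 G0) u - b2 0 eps' u
    - b2 0 H (b2 0 t e - b3 0 G0 H e)
    + (b2 0 t' (b2 1 H e) - b3 0 H G0 (b2 1 H e)).
Proof.
case=> ce cu.
have E1 := @b1b3 K NuncAB 0 0 0 1 1 1 0 0 (-1) 0 _ _ _ _ H G0 u erefl erefl erefl erefl erefl erefl.
have E2 := @b1b2 K NuncAB (-1) 0 0 1 (-1) 0 _ _ _ t' u erefl erefl erefl.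
rewrite cH cu b30l addr0 sgnN1 !scaleN1r scale1r in E1.
rewrite cu (sgn_double K (-1)) scale1r in E2.
have E3 : b2 0 H G0 = eps' + one g + b1 0 t'.
  by rewrite /eps' addrAC !subrK.
rewrite E3 b2Dl b2Dl (nunc_one_l hB u) in E1.
rewrite /ustep /tstep /dstep b1B -addrA b2Dr (b2Br _ H).
move: E1 E2; rewrite -!addrA => /eqP; rewrite addr_eq0 => /eqP->.
move=> /eqP; rewrite addr_eq0 => /eqP->.
rewrite (b2Br _ H) !(opprD, opprK) !addrA.
(* the parentheses collect the cancelling pairs *)
rewrite [LHS](ACl (11*7*4*3*6*12*(1*8)*(2*10)*(5*9))) /=.
by rewrite !(addrN, addNr, addr0).
Qed.

Lemma dstep_vanish k e u : vanish k e -> vanish k u -> vanish k (dstep e u).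
Proof.
move=> ve vu; apply: vanishD; last exact: (vanish_b2 _ (vanish0 t) ve).
apply: vanishB; first exact: (vanish_b2 _ (vanish0 G0) vu).
exact: (vanish_b3 _ (vanish0 G0) (vanish0 H) ve).
Qed.

Lemma tstep_vanish k u : vanish k u -> vanish k (tstep u).
Proof.
move=> vu; apply: vanishB; first exact: (vanish_b2 _ (vanish0 t') vu).
exact: (vanish_b3 _ (vanish0 H) (vanish0 G0) vu).
Qed.

(** Together with [ustep_vanish]: from filtrations (k, k) to (k + 1, k), and
    from (k + 1, k) to (k + 1, k + 1). *)
Lemma estep_vanish k e u : cone_cycle e u ->
  vanish k e -> vanish k u -> vanish k.+1 (estep e u).
Proof.
move=> c ve vu; rewrite estepE //; apply: vanishB; first apply: vanishB.
- exact: (vanish_b2 _ vG vu).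
- exact: (vanish_b2 _ veps ve).
by apply: (vanish_b3 _ vG (vanish0 H) ve); rewrite addn0.
Qed.

Lemma ustep_vanish k e u : cone_cycle e u ->
  vanish k e -> vanish k.-1 u -> vanish k (ustep e u).
Proof.
move=> c ve vu; rewrite ustepE //.
have vHe : vanish k (b2 1 H e) by exact: (vanish_b2 _ (vanish0 H) ve).
apply: vanishD; last first.
  apply: vanishB; first exact: (vanish_b2 _ (vanish0 t') vHe).
  exact: (vanish_b3 _ (vanish0 H) (vanish0 G0) vHe).
apply: vanishB; last first.
  apply: (vanish_b2 _ (vanish0 H) (j := k)) => //.
  apply: vanishB; first exact: (vanish_b2 _ (vanish0 t) ve).
  exact: (vanish_b3 _ (vanish0 G0) (vanish0 H) ve).
apply: vanishB; last by apply: (vanish_b2 _ veps' vu); lia.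
by apply: (vanish_b3 _ (vanish0 H) vG vu); lia.
Qed.

(** What is left of (0, id_g) after n corrections by boundaries of the cone. *)
Fixpoint residue (n : nat) : gr_hom NuncAB g f 1 * gr_hom NuncAB g g 0 :=
  if n is n'.+1 then
    (estep (residue n').1 (residue n').2, ustep (residue n').1 (residue n').2)
  else (0, one g).

Lemma residue_cycle n : cone_cycle (residue n).1 (residue n).2.
Proof.
elim: n => [|n IH]; last exact: cone_step.
split; first exact: b1_0.
by rewrite [LHS](one_cycle g) [RHS]b20r.
Qed.

Lemma residue_vanish n :
  vanish (uphalf n) (residue n).1 /\ vanish n./2 (residue n).2.
Proof.
elim: n => [|n [ve vu]]; first by split; exact: vanish0.
have c := residue_cycle n; split.
  apply: estep_vanish => //; apply: vanishW ve.
  by rewrite uphalf_half leq_addl.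
apply: ustep_vanish => //; apply: vanishW vu.
by rewrite -[n.+1./2]/(uphalf n) uphalf_half; case: (odd n) => /=; rewrite ?leq_pred.
Qed.

Let dn n := dstep (residue n).1 (residue n).2.
Let tn n := tstep (residue n).2.

Lemma dn_vanish n : vanish n./2 (dn n).
Proof.
have [ve vu] := residue_vanish n; apply: dstep_vanish => //.
by apply: vanishW ve; rewrite uphalf_half leq_addl.
Qed.

Lemma tn_vanish n : vanish n./2 (tn n).
Proof. by have [_ vu] := residue_vanish n; apply: tstep_vanish. Qed.

Lemma residue1 n : (residue n).1 = - b1 1 (\sum_(j < n) dn j).
Proof.
elim: n => [|n IH]; first by rewrite big_ord0 b1_0 oppr0.
have -> : b1 1 (\sum_(j < n.+1) dn j) = b1 1 (\sum_(j < n) dn j) + b1 1 (dn n).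
  by rewrite big_ord_recr; exact: b1D.
by rewrite opprD -IH.
Qed.

Lemma residue2 n : (residue n).2 =
  one g - b2 0 H (\sum_(j < n) dn j) - b1 0 (\sum_(j < n) tn j).
Proof.
elim: n => [|n IH]; first by rewrite !big_ord0 b1_0 b20r !subr0.
have -> : b1 0 (\sum_(j < n.+1) tn j) = b1 0 (\sum_(j < n) tn j) + b1 0 (tn n).
  by rewrite big_ord_recr; exact: b1D.
have -> : b2 0 H (\sum_(j < n.+1) dn j) = b2 0 H (\sum_(j < n) dn j) + b2 0 H (dn n).
  by rewrite big_ord_recr; exact: b2Dr.
transitivity ((residue n).2 - b2 0 H (dn n) - b1 0 (tn n)) => //.
by rewrite IH !opprD !addrA; congr (_ + _); rewrite addrAC.
Qed.

Lemma vanish_all (f1 f2 : N) d (x : gr_hom N f1 f2 d) :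
  (forall n, vanish n x) -> x = 0.
Proof. by move=> v; apply: cochain_ext => X Z p; apply: (v (csize p).+1). Qed.

(** The equations hold on chains of length n because the first 2 (n + 1)
    corrections already solve them there. *)
Lemma right_inverse_exists :
  exists G : gr_hom NuncAB g f 0, cycle0 G /\ homologous (comp0 H G) (one g).
Proof.
pose G : gr_hom NuncAB g f 0 := stable_sum dn; pose T : gr_hom NuncAB g g (-1) := stable_sum tn.
have rG n : vanish n (G - \sum_(j < n.*2) dn j) by apply: stable_sum_approx; exact: dn_vanish.
have rT n : vanish n (T - \sum_(j < n.*2) tn j) by apply: stable_sum_approx; exact: tn_vanish.
exists G; split; first apply/cycle0E.
  apply: (@vanish_all g f 1) => n.
  rewrite -[G](subrK (\sum_(j < n.*2) dn j)) b1D; apply: vanishD.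
    exact: vanish_b1.
  rewrite -[b1 1 _]opprK -residue1; apply: vanishN.
  by have [ve _] := residue_vanish n.*2; rewrite uphalf_double in ve.
rewrite comp0E; apply/homologousE; exists (- T).
apply/eqP; rewrite eq_sym -subr_eq0 b1N opprK; apply/eqP.
apply: (@vanish_all g g 0) => n.
rewrite -[G](subrK (\sum_(j < n.*2) dn j)) -[T](subrK (\sum_(j < n.*2) tn j)).
rewrite b1D b2Dr.
have -> : b2 0 H (G - \sum_(j < n.*2) dn j) + b2 0 H (\sum_(j < n.*2) dn j) - one g +
    (b1 0 (T - \sum_(j < n.*2) tn j) + b1 0 (\sum_(j < n.*2) tn j)) =
    b2 0 H (G - \sum_(j < n.*2) dn j) + b1 0 (T - \sum_(j < n.*2) tn j)
    - (residue n.*2).2.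
  rewrite residue2 !(opprD, opprK) !addrA.
  by rewrite [LHS](ACl (1*4*3*2*5)).
apply: vanishB; first apply: vanishD.
- exact: (vanish_b2 _ (vanish0 H) (rG n)).
- exact: vanish_b1.
by have [_ vu] := residue_vanish n.*2; rewrite doubleK in vu.
Qed.

End Cone.

(** * Weak equivalences *)

Section WeakEquivalences.
Variables (K : fieldType) (A B : ainf_cat K).
Variable oneB : forall X : B, gr_hom B X X 0.
Hypothesis hB : strictly_unital oneB.
Local Notation N := (nunc_quiver A B).
Local Notation NuncAB := (NuncCat A B).
Local Notation one := (nunc_one oneB).

Lemma b2_one_l (X Y : B) (x : gr_hom B X Y 0) : b2 0 (oneB Y) x = x.
Proof. by rewrite /b2 (bh_one_l hB) at_deg_id. Qed.

Lemma b2_one_r (X Y : B) (x : gr_hom B X Y 0) : b2 0 x (oneB X) = x.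
Proof. by rewrite /b2 (bh_one_r hB) at_deg_scale at_deg_id scale1r. Qed.

Lemma zero_componentB (f g : NuncAB) (H H' : gr_hom NuncAB f g 0) X :
  zero_component (H - H') X = zero_component H X - zero_component H' X.
Proof. by rewrite /zero_component cochainDE -scaleN1r cochainZE scaleN1r. Qed.

Lemma cycle0_at_nil (f g : NuncAB) (H : gr_hom NuncAB f g 0) X :
  cycle0 H -> cycle0 (zero_component H X).
Proof. by move/cycle0E => c; apply/cycle0E; rewrite -b1_at_nil c. Qed.

Lemma homologous_at_nil (f g : NuncAB) (H H' : gr_hom NuncAB f g 0) X :
  homologous H H' -> homologous (zero_component H X) (zero_component H' X).
Proof.
case/homologousE => z E; apply/homologousE; exists (cochain_val z (cnil X)).
by rewrite -[LHS]b1_at_nil_htpy E zero_componentB.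
Qed.

Lemma comp0_at_nil (f g h : NuncAB) (G : gr_hom NuncAB g h 0) (H : gr_hom NuncAB f g 0) X :
  zero_component (comp0 G H) X = comp0 (zero_component G X) (zero_component H X).
Proof. by rewrite !comp0E b2_at_nil. Qed.

(** The inverses and homotopies given objectwise are chosen simultaneously and
    extended by zero. *)
Lemma pointwise_iso_right_inverse (f g : NuncAB) (H : gr_hom NuncAB f g 0) :
  cycle0 H -> (forall X, H0_iso oneB (zero_component H X)) ->
  exists G : gr_hom NuncAB g f 0, cycle0 G /\ homologous (comp0 H G) (one g).
Proof.
move=> /cycle0E cH iso.
pose T X := (gr_hom B (g X) (f X) 0 * gr_hom B (f X) (f X) (-1) *
             gr_hom B (g X) (g X) (-1))%type.
have ex X : exists d : T X, [/\ b1 1 d.1.1 = 0,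
    b1 0 d.1.2 = b2 0 d.1.1 (zero_component H X) - oneB (f X) &
    b1 0 d.2 = b2 0 (zero_component H X) d.1.1 - oneB (g X)].
  have [_ [y [/cycle0E cy]]] := iso X.
  rewrite !comp0E => /homologousE[s Es] /homologousE[w Ew].
  by exists (y, s, w).
pose D X : T X := sval (cid (ex X)).
have hD X := svalP (cid (ex X)).
pose G0 : gr_hom NuncAB g f 0 := point_cochain (fun X => (D X).1.1).
pose t : gr_hom NuncAB f f (-1) := point_cochain (fun X => (D X).1.2).
pose t' : gr_hom NuncAB g g (-1) := point_cochain (fun X => (D X).2).
apply: (@right_inverse_exists K A B oneB hB f g H G0 t t' cH).
- by apply: vanish1 => X; rewrite b1_at_nil point_at_nil; case: (hD X).
- apply: vanish1 => X; have [_ E _] := hD X.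
  transitivity (zero_component (b2 0 G0 H - one f - b1 0 t : gr_hom NuncAB f f 0) X) => //.
  rewrite !zero_componentB b2_at_nil point_at_nil b1_at_nil_htpy point_at_nil_htpy.
  by rewrite [b1 0 _]E; apply: addrN.
apply: vanish1 => X; have [_ _ E] := hD X.
transitivity (zero_component (b2 0 H G0 - one g - b1 0 t' : gr_hom NuncAB g g 0) X) => //.
rewrite !zero_componentB b2_at_nil point_at_nil b1_at_nil_htpy point_at_nil_htpy.
by rewrite [b1 0 _]E; apply: addrN.
Qed.

Lemma homologous_b2 (D : ainf_cat K) (X Y Z : D) (x : gr_hom D Y Z 0)
    (y y' : gr_hom D X Y 0) (z : gr_hom D X Z 0) :
  cycle0 x -> homologous y y' -> homologous (comp0 x y') z -> homologous (comp0 x y) z.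
Proof.
move=> /cycle0E cx /homologousE[s Es] /homologousE[w Ew]; apply/homologousE.
exists (b2 (-1) x s + w); rewrite b1D Ew !comp0E.
rewrite -(@b2_cycle_b1 _ D (-1) 0 (-1)) // Es b2Br addrA subrK.
by [].
Qed.

Lemma homologous_b2l (D : ainf_cat K) (X Y Z : D) (x : gr_hom D X Y 0)
    (y y' : gr_hom D Y Z 0) (z : gr_hom D X Z 0) :
  cycle0 x -> homologous y y' -> homologous (comp0 y x) z -> homologous (comp0 y' x) z.
Proof.
move=> /cycle0E cx /homologousE[s Es] /homologousE[w Ew]; apply/homologousE.
exists (b2 (-1) s x + w); rewrite b1D Ew !comp0E.
have -> : b1 0 (b2 (-1) s x) = b2 0 (y' - y) x.
  by rewrite -[RHS]opprK -b2Nl opprB -Es (@b2_b1_cycle _ D (-1) 0) ?opprK.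
by rewrite b2Bl addrA subrK.
Qed.

(** A right inverse G of H satisfies the hypotheses of
    [pointwise_iso_right_inverse], its components being right inverses of
    invertible elements. *)
Lemma pointwise_iso_weak_equivalence (f g : NuncAB) (H : gr_hom NuncAB f g 0) :
  cycle0 H -> (forall X, H0_iso oneB (zero_component H X)) ->
  weak_equivalence oneB H.
Proof.
move=> cH iso; have [G [cG HG]] := pointwise_iso_right_inverse cH iso.
have isoG X : H0_iso oneB (zero_component G X).
  split; first exact: cycle0_at_nil.
  have hX := cycle0_at_nil X cH; have gX := cycle0_at_nil X cG.
  have hg : homologous (comp0 (zero_component H X) (zero_component G X)) (oneB (g X)).
    by rewrite -comp0_at_nil; exact: (homologous_at_nil X HG).
  exists (zero_component H X); split => //.
  have [_ [y [cy yh hy]]] := iso X.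
  have yg := inverses_homologous b2_one_l b2_one_r hX cy gX yh hg.
  exact: (homologous_b2l hX yg yh).
have [H' [cH' GH']] := pointwise_iso_right_inverse cG isoG.
split=> //; exists G; split=> //.
have HH' := @inverses_homologous K NuncAB one (fun f1 f2 => @nunc_one_l K A B oneB hB f1 f2 0)
  _ g f G H H' cG cH cH' HG GH'.
apply: (@homologous_b2 NuncAB) cG _ GH'.
apply: HH' => f1 f2 x.
by rewrite (@nunc_one_r K A B oneB hB) scale1r.
Qed.

Lemma mix_cnil_csing (W : lmodType K) (f : N) (X Y : A) (x : gr_hom A X Y 0)
    (Phi : gchain B (f X) (f Y) -> W) :
  lcomb (mix (cnil f) (csing (hom_elt x))) Phi = Phi (csing (hom_elt (H0_fun f x))).
Proof.
rewrite mix_cnil big_seq1 /=; congr (Phi (csing _)).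
set p := csing _; rewrite -[LHS](@hom_elt_at_deg _ _ 0) //; congr hom_elt.
by rewrite at_deg_scale (_ : omega_sign p = 1) ?scale1r // /= mulr0 mulr1.
Qed.

(** The value of b_1 H = 0 on x is b_2(h_Y, f x) + b_1(H x) - b_2(g x, h_X), as
    H(b_1 x) vanishes. *)
Lemma zero_component_natural (f g : NuncAB) (H : gr_hom NuncAB f g 0) (X Y : A)
    (x : gr_hom A X Y 0) :
  cycle0 H -> cycle0 x ->
  homologous (comp0 (zero_component H Y) (H0_fun f x))
             (comp0 (H0_fun g x) (zero_component H X)).
Proof.
move=> /cycle0E cH /cycle0E cx; apply/homologousE.
pose p : gchain A X Y := csing (hom_elt x).
exists (- (cochain_val H p : gr_hom B (f X) (g Y) (-1))).
have := congr1 (fun G : gr_hom NuncAB f g 1 => (cochain_val G p : gr_hom B (f X) (g Y) 0)) cH.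
have -> : (cochain_val (b1 1 H : gr_hom NuncAB f g 1) p : gr_hom B (f X) (g Y) 0) =
  nunc_b (csing (hom_elt (H : gr_hom N f g 0))) p 0.
  exact: (@cochain_bh _ A B f g (csing (hom_elt H)) 1 X Y p isT erefl).
rewrite nunc_bE mix_csing nunc_b1_extra_csing.
rewrite bhat_cons bhat_nil csum_nil scaler0 addr0.
rewrite (_ : at_deg 0 (cochain_app _ _) = 0); last first.
  rewrite (@b1_elt _ A 0 1) // cx.
  exact: (elin0 1 (mlin_elin (cnil _) (cnil _) (cochain_app_lin (hom_elt (H : gr_hom N f g 0)) 0))).
rewrite scaler0 addr0 !(csum_cons, csum_nil).
rewrite !mix_cnil_nil !mix_cnil_csing.
rewrite (_ : sgn _ = 1) // !scale1r mix_cnil_nil (_ : sgn _ = -1) // scaleN1r => E.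
rewrite b1N !comp0E; apply/eqP; rewrite eq_sym -addr_eq0 addrAC; apply/eqP.
exact: E.
Qed.

End WeakEquivalences.

Theorem proposition8p2p2p3 (K : fieldType) (A B : ainf_cat K)
    (oneA : forall X : A, gr_hom A X X 0) (oneB : forall X : B, gr_hom B X X 0)
    (hA : strictly_unital oneA) (hB : strictly_unital oneB)
    (f g : ainf_functor A B)
    (hf : strictly_unital_functor oneA oneB f)
    (hg : strictly_unital_functor oneA oneB g)
    (H : gr_hom (Nunc A B) f g 0) (hH : cycle0 H) :
  weak_equivalence oneB H <-> H0_natural_iso oneB (zero_component H).
Proof.
split=> [[_ [G [cG GH HG]]]|[_ _ iso]]; last exact: (pointwise_iso_weak_equivalence hB).
have cX X := @cycle0_at_nil K A B f g H X hH.
split=> [//|X Y x cx|X]; first exact: (@zero_component_natural K A B f g H).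
split=> //; exists (zero_component G X).
split; first exact: (@cycle0_at_nil K A B g f G X cG).
  by rewrite -comp0_at_nil; exact: (@homologous_at_nil K A B f f _ _ X GH).
by rewrite -comp0_at_nil; exact: (@homologous_at_nil K A B g g _ _ X HG).
Qed.
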